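(* Let $(\mathcal{S},G,\mathfrak{g},\alpha)$ be an operator system dynamical system with $G$ amenable. Then $\mathcal{S}\rtimes_{\alpha,\lambda}\mathfrak{g}=\mathcal{S}\rtimes_{\alpha,\mathrm{env}}\mathfrak{g}$.
   Context: An (operator system) dynamical system $(\mathcal{S},G,\mathfrak{g},\alpha)$ consists of an operator system $\mathcal{S}$, a discrete group $G$, a generating set $\mathfrak{g}$ of $G$ with $\mathfrak{g}^{-1}=\mathfrak{g}$ and $e\in\mathfrak{g}$, and a group homomorphism $\alpha:G\to\mathrm{Aut}(\mathcal{S})$ into the group of unital complete order isomorphisms of $\mathcal{S}$. $C^*_{\mathrm{env}}(\mathcal{S})$ is the $C^*$-envelope of $\mathcal{S}$; the action $\alpha$ extends uniquely to an action of $G$ on it by $*$-automorphisms, again denoted $\alpha$. The reduced crossed product is $\mathcal{S}\rtimes_{\alpha,\lambda}\mathfrak{g}:=\mathrm{span}\{a\lambda_g:a\in\mathcal{S},g\in\mathfrak{g}\}\subset C^*_{\mathrm{env}}(\mathcal{S})\rtimes_{\alpha,\lambda}G$ (reduced $C^*$-crossed product, canonical unitaries $\lambda_g$). The full enveloping crossed product is $\mathcal{S}\rtimes_{\alpha,\mathrm{env}}\mathfrak{g}:=\mathrm{span}\{au_g:a\in\mathcal{S},g\in\mathfrak{g}\}\subset C^*_{\mathrm{env}}(\mathcal{S})\rtimes_{\alpha}G$ (full $C^*$-crossed product, canonical unitaries $u_g$). Both are operator systems with the inherited structure. The equality means that the canonical map $au_g\mapsto a\lambda_g$ is a unital complete order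 isomorphism. *)

(* Defs.v *)
From HB Require Import structures.
From mathcomp Require Import all_boot all_order all_algebra sesquilinear.
From mathcomp Require Import complex.
From mathcomp Require Import all_classical all_reals all_analysis.

Set Implicit Arguments.
Unset Strict Implicit.
Unset Printing Implicit Defensive.

Import Order.TTheory GRing.Theory Num.Theory.
Import numFieldNormedType.Exports.

Local Open Scope classical_set_scope.
Local Open Scope ring_scope.

(* In this file R : realType and the scalars are the complex numbers R[i].
   The norm of a normedModType R[i] takes its values in R[i]; rnorm is the same
   norm, seen as a real number. *)
Definition rnorm (R : realType) (E : normedModType R[i]) (x : E) : R :=
  complex.Re `|x|.

(** * C*-algebras *)

(* A (nonzero) unital C*-algebra is a complex Banach space with a product, a
   unit and an involution. The data are put on a Banach space by a plain record
   because Hierarchy Builder has no join of the normed and the ring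
   hierarchies; the carrier then receives both structures. *)
Record cstarAlgebra (R : realType) := CStarAlgebra {
  cs_banach : completeNormedModType R[i] ;
  cs_mul : cs_banach -> cs_banach -> cs_banach ;
  cs_one : cs_banach ;
  cs_star : cs_banach -> cs_banach ;
  cs_mulA : associative cs_mul ;
  cs_mul1l : left_id cs_one cs_mul ;
  cs_mul1r : right_id cs_one cs_mul ;
  cs_mulDl : left_distributive cs_mul +%R ;
  cs_mulDr : right_distributive cs_mul +%R ;
  cs_one_neq0 : cs_one != 0 ;
  cs_scaleAl : forall (a : R[i]) x y, a *: cs_mul x y = cs_mul (a *: x) y ;
  cs_scaleAr : forall (a : R[i]) x y, a *: cs_mul x y = cs_mul x (a *: y) ;
  cs_starK : involutive cs_star ;
  cs_star_conjlin : forall (a : R[i]) x y,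
    cs_star (a *: x + y) = a^* *: cs_star x + cs_star y ;
  cs_starM : forall x y, cs_star (cs_mul x y) = cs_mul (cs_star y) (cs_star x) ;
  cs_norm_mul_le : forall x y, `|cs_mul x y| <= `|x| * `|y| ;
  cs_norm_starM : forall x, `|cs_mul (cs_star x) x| = `|x| ^+ 2
}.

Definition cs_carrier (R : realType) (A : cstarAlgebra R) : Type := cs_banach A.
Coercion cs_carrier : cstarAlgebra >-> Sortclass.

HB.instance Definition _ (R : realType) (A : cstarAlgebra R) :=
  CompleteNormedModule.copy (cs_carrier A) (cs_banach A).
HB.instance Definition _ (R : realType) (A : cstarAlgebra R) :=
  GRing.Zmodule_isNzRing.Build (cs_carrier A) (@cs_mulA R A) (@cs_mul1l R A)
    (@cs_mul1r R A) (@cs_mulDl R A) (@cs_mulDr R A) (@cs_one_neq0 R A).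
HB.instance Definition _ (R : realType) (A : cstarAlgebra R) :=
  GRing.Lmodule_isLalgebra.Build R[i] (cs_carrier A) (@cs_scaleAl R A).
HB.instance Definition _ (R : realType) (A : cstarAlgebra R) :=
  GRing.Lalgebra_isAlgebra.Build R[i] (cs_carrier A) (@cs_scaleAr R A).

Definition star (R : realType) (A : cstarAlgebra R) : A -> A := @cs_star R A.

(* *-homomorphisms are unital. *)
Definition star_hom (R : realType) (A B : cstarAlgebra R) (f : A -> B) : Prop :=
  [/\ linear f, monoid_morphism f & forall x, f (star x) = star (f x)].

(** * Matrix cones and operator systems *)

Definition mxcones (V : Type) := forall n : nat, set 'M[V]_n.

Definition mxstar (V : Type) (st : V -> V) (n : nat) (X : 'M[V]_n) : 'M[V]_n :=
  (map_mx st X)^T.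

(* The positive elements of the C*-algebra M_n(A) are the Y^* Y. *)
Definition cs_pos (R : realType) (A : cstarAlgebra R) : mxcones A :=
  fun n X => exists Y : 'M[A]_n, X = mxstar (@star R A) Y *m Y.

Definition complete_order_embedding (V W : Type) (P : mxcones V)
    (Q : mxcones W) (f : V -> W) : Prop :=
  forall n (X : 'M[V]_n), P n X <-> Q n (map_mx f X).

(* T^* X T, for a scalar matrix T *)
Definition mxcompress (R : realType) (V : lmodType R[i]) (n m : nat)
    (T : 'M[R[i]]_(n, m)) (X : 'M[V]_n) : 'M[V]_m :=
  \matrix_(i, j) \sum_k \sum_l ((T k i)^* * T l j) *: X k l.

(* r e_n = diag(r e, ..., r e) *)
Definition mxunit (R : realType) (V : lmodType R[i]) (e : V) (r : R) (n : nat) :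
    'M[V]_n :=
  \matrix_(i, j) (((r%:C)%C *: e) *+ (i == j)).

(* (Nonzero) abstract operator systems, after Choi and Effros: matrix ordered
   complex *-vector spaces with an Archimedean matrix order unit. *)
Record operatorSystem (R : realType) := OperatorSystem {
  os_space :> lmodType R[i] ;
  os_star : os_space -> os_space ;
  os_unit : os_space ;
  os_pos : mxcones os_space ;
  os_unit_neq0 : os_unit != 0 ;
  os_starK : involutive os_star ;
  os_star_conjlin : forall (a : R[i]) x y,
    os_star (a *: x + y) = a^* *: os_star x + os_star y ;
  os_star_unit : os_star os_unit = os_unit ;
  os_pos_herm : forall n (X : 'M[os_space]_n), os_pos X -> mxstar os_star X = X ;
  os_posD : forall n (X Y : 'M[os_space]_n),
    os_pos X -> os_pos Y -> os_pos (X + Y) ;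
  os_pos_compress : forall n m (T : 'M[R[i]]_(n, m)) (X : 'M[os_space]_n),
    os_pos X -> os_pos (mxcompress T X) ;
  os_pos_proper : forall n (X : 'M[os_space]_n),
    os_pos X -> os_pos (- X) -> X = 0 ;
  os_order_unit : forall n (X : 'M[os_space]_n), mxstar os_star X = X ->
    exists2 r : R, 0 < r & os_pos (mxunit os_unit r n + X) ;
  os_archimedean : forall n (X : 'M[os_space]_n),
    (forall r : R, 0 < r -> os_pos (mxunit os_unit r n + X)) -> os_pos X
}.

Definition os_automorphism (R : realType) (S : operatorSystem R)
    (f : S -> S) : Prop :=
  [/\ linear f, bijective f, f (os_unit S) = os_unit S
    & complete_order_embedding (@os_pos R S) (@os_pos R S) f].

(* theta restricts to a unital complete order isomorphism from the operator
   system V, contained in A, onto the operator system W, contained in B; V and W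
   carry the matrix orders of A and B. *)
Definition ucoi_between (R : realType) (A B : cstarAlgebra R) (V : set A)
    (W : set B) (theta : A -> B) : Prop :=
  [/\ forall (a : R[i]) x y, V x -> V y ->
        theta (a *: x + y) = a *: theta x + theta y,
      set_bij V W theta,
      theta 1 = 1
    & forall n (X : 'M[A]_n), (forall i j, V (X i j)) ->
        (cs_pos X <-> cs_pos (map_mx theta X))].

(** * C*-envelopes *)

Definition cstar_generates (R : realType) (A : cstarAlgebra R) (X : set A) :
    Prop :=
  forall D : set A, closed D -> D 1 ->
    (forall (a : R[i]) x y, D x -> D y -> D (a *: x + y)) ->
    (forall x y, D x -> D y -> D (x * y)) ->
    (forall x, D x -> D (star x)) ->
    X `<=` D -> D = setT.

Definition cstar_cover (R : realType) (S : operatorSystem R)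
    (A : cstarAlgebra R) (iota : S -> A) : Prop :=
  [/\ linear iota, iota (os_unit S) = 1,
      complete_order_embedding (@os_pos R S) (@cs_pos R A) iota
    & cstar_generates (range iota)].

(* Hamana's universal property: the C*-envelope is the smallest C*-cover. *)
Definition cstar_envelope (R : realType) (S : operatorSystem R)
    (A : cstarAlgebra R) (iota : S -> A) : Prop :=
  cstar_cover iota /\
  forall (B : cstarAlgebra R) (kappa : S -> B), cstar_cover kappa ->
    exists2 Phi : B -> A, star_hom Phi & forall s, Phi (kappa s) = iota s.

(** * Groups and dynamical systems *)

Definition generates (G : groupType) (gen : set G) : Prop :=
  forall D : set G, D 1%g -> (forall g h, D g -> D h -> D (g * h)%g) ->
    (forall g, D g -> D g^-1%g) -> gen `<=` D -> D = setT.

Definition bounded_real_fun (R : realType) (T : Type) (f : T -> R) : Prop :=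
  exists M : R, forall t, `|f t| <= M.

(* There is a left invariant mean on l^oo(G); the values of m outside the
   bounded functions are irrelevant. *)
Definition amenable (R : realType) (G : groupType) : Prop :=
  exists m : (G -> R) -> R,
    [/\ forall (a : R) (f h : G -> R),
          bounded_real_fun f -> bounded_real_fun h ->
          m (fun g => a * f g + h g) = a * m f + m h,
        forall f, bounded_real_fun f -> (forall g, 0 <= f g) -> 0 <= m f,
        m (fun=> 1) = 1
      & forall f (h : G), bounded_real_fun f ->
          m (fun g => f (h * g)%g) = m f].

Definition os_dynamical_system (R : realType) (S : operatorSystem R)
    (G : groupType) (gen : set G) (alpha : G -> S -> S) : Prop :=
  [/\ [/\ generates gen, (forall g, gen g -> gen g^-1%g) & gen 1%g],
      forall g, os_automorphism (alpha g)
    & forall g h s, alpha (g * h)%g s = alpha g (alpha h s)].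

Definition cstar_action (R : realType) (A : cstarAlgebra R) (G : groupType)
    (beta : G -> A -> A) : Prop :=
  (forall g, star_hom (beta g) /\ bijective (beta g)) /\
  (forall g h a, beta (g * h)%g a = beta g (beta h a)).

(** * Representations on Hilbert spaces *)

Record hilbertSpace (R : realType) := HilbertSpace {
  hs_space :> completeNormedModType R[i] ;
  hs_dot : {dot hs_space for Num.conj} ;
  hs_normE : forall x : hs_space, `|x| ^+ 2 = hs_dot x x
}.

Definition bounded_operator (R : realType) (H : hilbertSpace R) (T : H -> H) :
    Prop :=
  linear T /\ exists M : R, forall xi, rnorm (T xi) <= M * rnorm xi.

(* unital *-homomorphisms from A to B(H) *)
Definition star_rep (R : realType) (A : cstarAlgebra R) (H : hilbertSpace R)
    (pi : A -> H -> H) : Prop :=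
  [/\ [/\ forall a, bounded_operator (pi a)
        & forall (c : R[i]) a b xi,
            pi (c *: a + b) xi = c *: pi a xi + pi b xi],
      forall a b xi, pi (a * b) xi = pi a (pi b xi),
      forall xi, pi 1 xi = xi
    & forall a xi eta, hs_dot H (pi a xi) eta = hs_dot H xi (pi (star a) eta)].

(* A faithful representation, i.e. a realization of A as a C*-subalgebra of
   B(H): the norm of A is the operator norm. *)
Definition faithful_rep (R : realType) (A : cstarAlgebra R)
    (H : hilbertSpace R) (pi : A -> H -> H) : Prop :=
  star_rep pi /\
  forall a (M : R), 0 <= M ->
    (rnorm a <= M <-> forall xi, rnorm (pi a xi) <= M * rnorm xi).

Definition unitary_rep (R : realType) (G : groupType) (H : hilbertSpace R)
    (U : G -> H -> H) : Prop :=
  [/\ forall g, linear (U g),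
      forall g xi eta, hs_dot H (U g xi) (U g eta) = hs_dot H xi eta,
      forall g h xi, U (g * h)%g xi = U g (U h xi)
    & forall xi, U 1%g xi = xi].

Definition covariant_rep (R : realType) (A : cstarAlgebra R) (G : groupType)
    (beta : G -> A -> A) (H : hilbertSpace R) (rho : A -> H -> H)
    (U : G -> H -> H) : Prop :=
  [/\ star_rep rho, unitary_rep U
    & forall g a xi, U g (rho a xi) = rho (beta g a) (U g xi)].

(** * Crossed products *)

(* A list s : seq (A * G) stands for the element sum_((a, g) in s) a g of the
   *-algebra C_c(G, A) of finitely supported functions from G to A. *)

(* M bounds the universal norm of s, the supremum over all covariant
   representations of the norms of the images of s. *)
Definition full_norm_le (R : realType) (A : cstarAlgebra R) (G : groupType)
    (beta : G -> A -> A) (s : seq (A * G)) (M : R) : Prop :=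
  forall (H : hilbertSpace R) (rho : A -> H -> H) (U : G -> H -> H),
    covariant_rep beta rho U ->
    forall xi : H,
      rnorm (\sum_(p <- s) rho p.1 (U p.2 xi)) <= M * rnorm xi.

(* the square of the norm of l^2(G, H), +oo outside l^2(G, H) *)
Definition l2_sqnorm (R : realType) (G : groupType) (H : hilbertSpace R)
    (xi : G -> H) : \bar R :=
  (\esum_(g in [set: G]) ((rnorm (xi g)) ^+ 2)%:E)%E.

(* the regular covariant representation on l^2(G, H) induced by pi *)
Definition induced_rep (R : realType) (A : cstarAlgebra R) (G : groupType)
    (beta : G -> A -> A) (H : hilbertSpace R) (pi : A -> H -> H)
    (a : A) (xi : G -> H) : G -> H :=
  fun g => pi (beta g^-1%g a) (xi g).

Definition left_translation (G : groupType) (T : Type) (h : G) (xi : G -> T) :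
    G -> T :=
  fun g => xi (h^-1 * g)%g.

(* M bounds the norm of the image of s under that representation. *)
Definition reduced_norm_le (R : realType) (A : cstarAlgebra R) (G : groupType)
    (beta : G -> A -> A) (H : hilbertSpace R) (pi : A -> H -> H)
    (s : seq (A * G)) (M : R) : Prop :=
  forall xi : G -> H, (l2_sqnorm xi < +oo)%E ->
    (l2_sqnorm (fun g : G => (\sum_(p <- s)
        induced_rep beta pi p.1 (left_translation p.2 xi) g)%R)
     <= (M ^+ 2)%:E * l2_sqnorm xi)%E.

Definition integrated (R : realType) (A B : cstarAlgebra R) (G : groupType)
    (j : A -> B) (u : G -> B) (s : seq (A * G)) : B :=
  \sum_(p <- s) j p.1 * u p.2.

(* B, with its canonical maps j and u from A and G, is the C*-algebra completion
   of the *-algebra C_c(G, A), twisted by beta, in the norm whose upper bounds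
   are given by norm_le. *)
Definition crossed_product_completion (R : realType) (A B : cstarAlgebra R)
    (G : groupType) (beta : G -> A -> A)
    (norm_le : seq (A * G) -> R -> Prop) (j : A -> B) (u : G -> B) : Prop :=
  [/\ star_hom j,
      [/\ u 1%g = 1, forall g h, u (g * h)%g = u g * u h
        & forall g, star (u g) * u g = 1 /\ u g * star (u g) = 1],
      forall g a, u g * j a * star (u g) = j (beta g a),
      closure (range (integrated j u)) = setT
    & forall s (M : R), 0 <= M -> (rnorm (integrated j u s) <= M <-> norm_le s M)].

Definition full_crossed_product (R : realType) (A B : cstarAlgebra R)
    (G : groupType) (beta : G -> A -> A) (j : A -> B) (u : G -> B) : Prop :=
  crossed_product_completion beta (full_norm_le beta) j u.

(* The reduced norm does not depend on the faithful representation. *)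
Definition reduced_crossed_product (R : realType) (A B : cstarAlgebra R)
    (G : groupType) (beta : G -> A -> A) (j : A -> B) (lam : G -> B) : Prop :=
  exists (H : hilbertSpace R) (pi : A -> H -> H),
    faithful_rep pi /\
    crossed_product_completion beta (reduced_norm_le beta pi) j lam.

(* The span of the a u_g, for a in S and g in gen; scalars are not needed since
   S is a vector space. *)
Definition os_crossed_product (R : realType) (S : operatorSystem R)
    (A B : cstarAlgebra R) (G : groupType) (gen : set G) (iota : S -> A)
    (j : A -> B) (u : G -> B) : set B :=
  [set x | exists2 s : seq (S * G), (forall p, p \in s -> gen p.2)
         & x = \sum_(p <- s) j (iota p.1) * u p.2].

(* Main.v *)
Require Import Defs.
From HB Require Import structures.
From mathcomp Require Import all_boot all_order all_algebra sesquilinear.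
From mathcomp Require Import complex.
From mathcomp Require Import all_classical all_reals all_analysis.
From mathcomp Require Import ring lra.

(** Both crossed products are completions of the twisted *-algebra [C_c(G, A)], for
    [A] the C*-envelope. If the full and the reduced norms agree on [C_c(G, A)], then
    the identity extends to a *-isomorphism of the completions
    ([star_isomorphism_extension]). It maps [a u_g] to [a lambda_g], and as a
    *-isomorphism it preserves the cones of elements [Y^* Y] in all matrix algebras in
    both directions ([star_isomorphism_cs_pos]). The equality of the norms holds for
    every action of an amenable group on a C*-algebra.

    The reduced norm is at most the full norm because the regular representation on
    [l^2(G, H)] is covariant ([full_reduced_norm_le]). This requires the Hilbert space
    [l^2(G, H)], and the contractivity of representations ([rep_contractive]), which
    makes the induced operators act on square summable families.

    Conversely, let [(rho, U)] be a covariant representation on [K], and let [M] bound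
    the reduced norm of [s], computed with a faithful representation [pi].
    - The bound [M] also holds for the regular representation induced by [rho]
      ([reduced_norm_transfer]). On finitely supported vectors that representation is
      given by matrices over [A], and the image of a matrix under [rho] has norm at
      most that of its image under [pi] ([faithful_dominates]): this holds up to a
      factor [n^2], since [pi] is isometric and [rho] contractive on the entries, and
      the factor disappears when the inequality is applied to the powers
      [(C^* C)^(2^k)].
    - By Fell's absorption principle the regular representation induced by [rho]
      contains the operators [sum_p rho(a_p) U_(g_p) (x) lambda_(g_p)] on
      [K (x) l^2(G)], so [M] bounds these too ([fell_absorption]).
    - An invariant mean yields finitely supported probability vectors [f] that are
      almost invariant in [l^1(G)] under the finitely many [g_p]
      ([almost_invariant_vector]). Otherwise a Hahn-Banach functional
      ([additive_minorant]) would produce bounded functions whose coboundaries add up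
      to a function bounded below by a positive constant, while its mean is zero.
    - On vectors [xi (x) sqrt f] the operators above act almost as
      [sum_p rho(a_p) U_(g_p)] does on [xi], so [M] bounds the latter
      ([covariant_norm_le]). *)

Set Implicit Arguments.
Unset Strict Implicit.
Unset Printing Implicit Defensive.

Import Order.TTheory GRing.Theory Num.Theory.
Import numFieldNormedType.Exports.

Local Open Scope classical_set_scope.
Local Open Scope ring_scope.

(** * Norms and real inner products *)

Section Norm.
Variables (R : realType) (E : normedModType R[i]).
Implicit Types (x y : E).

Lemma rnormE x : `|x| = ((rnorm x)%:C)%C.
Proof. by rewrite /rnorm RRe_real // ger0_real. Qed.

Lemma rnorm_ge0 x : 0 <= rnorm x.
Proof. by rewrite -ler0c -rnormE. Qed.

Lemma rnorm0 : rnorm (0 : E) = 0.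
Proof. by rewrite /rnorm normr0. Qed.

Lemma rnorm_eq0 x : rnorm x = 0 -> x = 0.
Proof. by move=> x0; apply/normr0_eq0; rewrite rnormE x0. Qed.

Lemma rnormD x y : rnorm (x + y) <= rnorm x + rnorm y.
Proof. by rewrite -lecR rmorphD /= -!rnormE ler_normD. Qed.

Lemma rnormN x : rnorm (- x) = rnorm x.
Proof. by rewrite /rnorm normrN. Qed.

Lemma rnormB x y : rnorm (x - y) = rnorm (y - x).
Proof. by rewrite -rnormN opprB. Qed.

Lemma rnormZ (a : R[i]) x : rnorm (a *: x) = complex.Re `|a| * rnorm x.
Proof.
apply: complexI; transitivity `|a *: x|; first by rewrite rnormE.
rewrite normrZ rnormE -[in LHS](@RRe_real _ `|a|) ?ger0_real //.
by rewrite rmorphM.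
Qed.

Lemma rnormZr (r : R) x : rnorm ((r%:C)%C *: x) = `|r| * rnorm x.
Proof. by rewrite rnormZ normc_def /= expr0n /= addr0 sqrtr_sqr. Qed.

Lemma rnorm_lt x (r : R) : (rnorm x < r) = (`|x| < (r%:C)%C).
Proof. by rewrite rnormE ltcR. Qed.

End Norm.

Section RealInnerProduct.
Variables (R : realType) (H : hilbertSpace R).
Implicit Types (x y z : H).

(** Adjoints and positivity only see the real part of the inner product, which
    makes [H] a real inner product space. *)
Definition ip x y : R := complex.Re (hs_dot H x y).

Lemma hs_dotC x y : hs_dot H x y = (hs_dot H y x)^*.
Proof. by rewrite hermC /= expr0 mul1r. Qed.

Lemma ipC x y : ip x y = ip y x.
Proof. by rewrite /ip hs_dotC; case: (hs_dot H y x). Qed.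

Lemma ipDl x y z : ip (x + y) z = ip x z + ip y z.
Proof. by rewrite /ip linearDl /=; do 2 case: (hs_dot _ _ _). Qed.

Lemma ipDr x y z : ip x (y + z) = ip x y + ip x z.
Proof. by rewrite ipC ipDl ![ip _ x]ipC. Qed.

Lemma ipZl (r : R) x y : ip ((r%:C)%C *: x) y = r * ip x y.
Proof.
by rewrite /ip linearZl_LR /=; case: (hs_dot _ _ _) => u v /=; rewrite mul0r subr0.
Qed.

Lemma ipZr (r : R) x y : ip x ((r%:C)%C *: y) = r * ip x y.
Proof. by rewrite ipC ipZl ipC. Qed.

Lemma ipNl x y : ip (- x) y = - ip x y.
Proof. by rewrite /ip linearNl /=; case: (hs_dot _ _ _). Qed.

Lemma ipNr x y : ip x (- y) = - ip x y.
Proof. by rewrite ipC ipNl ipC. Qed.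

Lemma ipxx x : ip x x = rnorm x ^+ 2.
Proof. by rewrite /ip -hs_normE rnormE -rmorphXn. Qed.

Lemma ip_suml (I : Type) (s : seq I) (f : I -> H) y :
  ip (\sum_(i <- s) f i) y = \sum_(i <- s) ip (f i) y.
Proof.
elim: s => [|i s IH]; last by rewrite !big_cons ipDl IH.
by rewrite !big_nil /ip linear0l.
Qed.

Lemma ip_sumr (I : Type) (s : seq I) (f : I -> H) y :
  ip y (\sum_(i <- s) f i) = \sum_(i <- s) ip y (f i).
Proof. by rewrite ipC ip_suml; apply: eq_bigr => i _; rewrite ipC. Qed.

Lemma sqr_rnormD x y : rnorm (x + y) ^+ 2 =
  rnorm x ^+ 2 + 2 * ip x y + rnorm y ^+ 2.
Proof. by rewrite -!ipxx ipDl !ipDr (ipC y x); ring. Qed.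

Lemma sqr_rnormB x y : rnorm (x - y) ^+ 2 =
  rnorm x ^+ 2 - 2 * ip x y + rnorm y ^+ 2.
Proof. by rewrite sqr_rnormD ipNr rnormN; ring. Qed.

End RealInnerProduct.

(** The discriminant form of the Cauchy-Schwarz inequality, for single vectors as
    well as for finite families, where [a t^2 + 2 b t + c] is [|x + t y|^2]. *)
Lemma discriminant_le (R : realType) (a b c : R) : 0 <= a ->
  (forall t, 0 <= a * t ^+ 2 + 2 * b * t + c) -> b ^+ 2 <= a * c.
Proof.
move=> a0 ht; have [a_gt0|] := ltrP 0 a; last first.
  move=> a_le0; have -> : a = 0 by apply/le_anti; rewrite a_le0.
  have -> : b = 0; last by rewrite expr0n mul0r.
  apply/eqP/contraT => b0; have := ht (- (c + 1) / (2 * b)).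
  have -> : a = 0 by apply/le_anti; rewrite a_le0.
  rewrite mul0r add0r mulrC divfK ?mulf_neq0 ?pnatr_eq0 //.
  by move=> h; lra.
have := ht (- b / a).
have -> : a * (- b / a) ^+ 2 + 2 * b * (- b / a) + c = (a * c - b ^+ 2) / a.
  by field; rewrite gt_eqF.
by rewrite pmulr_lge0 ?invr_gt0 // subr_ge0.
Qed.

Section CauchySchwarz.
Variables (R : realType) (H : hilbertSpace R).

Lemma ip_le (x y : H) : ip x y <= rnorm x * rnorm y.
Proof.
apply: le_trans (ler_norm _) _.
rewrite -ler_sqr ?nnegrE ?mulr_ge0 ?rnorm_ge0 // exprMn -normrX ger0_norm ?sqr_ge0 //.
rewrite mulrC.
apply: discriminant_le => [|t]; first exact: sqr_ge0.
have := sqr_ge0 (rnorm (x + (t%:C)%C *: y)).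
rewrite sqr_rnormD ipZr rnormZr exprMn -normrX ger0_norm ?sqr_ge0 //.
by move=> h; lra.
Qed.

Lemma ip_sum_le (I : Type) (s : seq I) (x y : I -> H) :
  (\sum_(i <- s) ip (x i) (y i)) ^+ 2 <=
  (\sum_(i <- s) rnorm (x i) ^+ 2) * (\sum_(i <- s) rnorm (y i) ^+ 2).
Proof.
rewrite mulrC.
apply: discriminant_le => [|t]; first by apply: sumr_ge0 => i _; exact: sqr_ge0.
suff -> : (\sum_(i <- s) rnorm (y i) ^+ 2) * t ^+ 2 +
    2 * (\sum_(i <- s) ip (x i) (y i)) * t + \sum_(i <- s) rnorm (x i) ^+ 2 =
    \sum_(i <- s) rnorm (x i + (t%:C)%C *: y i) ^+ 2.
  by apply: sumr_ge0 => i _; exact: sqr_ge0.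
rewrite mulr_suml mulr_sumr mulr_suml -!big_split /=; apply: eq_bigr => i _.
rewrite sqr_rnormD ipZr rnormZr exprMn -normrX [in RHS]ger0_norm ?sqr_ge0 //.
by ring.
Qed.

Lemma sqr_rnorm_sum_le (I : Type) (s : seq I) (f : I -> H) :
  rnorm (\sum_(i <- s) f i) ^+ 2 <=
  (size s)%:R * \sum_(i <- s) rnorm (f i) ^+ 2.
Proof.
elim: s => [|i s IH]; first by rewrite !big_nil rnorm0 expr0n mulr0.
rewrite !big_cons /= sqr_rnormD ip_sumr.
have h : 2 * \sum_(j <- s) ip (f i) (f j) <=
   (size s)%:R * rnorm (f i) ^+ 2 + \sum_(j <- s) rnorm (f j) ^+ 2.
  rewrite {IH}; elim: s => [|j s IH].
    by rewrite !big_nil mulr0 mul0r addr0.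
  rewrite !big_cons /= mulrDr -natr1 mulrDl mul1r.
  have := sqr_ge0 (rnorm (f i - f j)); rewrite sqr_rnormB => h; lra.
by rewrite -natr1; lra.
Qed.

End CauchySchwarz.

(** * Automatic contractivity of representations *)

(** It removes a constant factor [C] from an inequality between high powers. *)
Lemma le_geometric (R : realType) (mu C x : R) : 0 <= mu < 1 ->
  (forall n, x <= C * mu ^+ n) -> x <= 0.
Proof.
move=> /andP[mu0 mu1] hx.
have : (C * mu ^+ n) @[n --> \oo] --> C * 0.
  by apply: cvgMr; apply: cvg_expr; rewrite ger0_norm.
rewrite mulr0 => h; rewrite -(cvg_lim _ h) //; apply: limr_ge.
  by apply/cvg_ex; exists 0.
exact: nearW.
Qed.

Lemma invn_lt (R : realType) (e : R) : 0 < e -> exists n, 2 / n.+1%:R < e.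
Proof.
move=> e0; have [n hn] : exists n, 2 / e < n.+1%:R.
  exists (Num.truncn (2 / e)); exact: truncnS_gt.
by exists n; rewrite ltr_pdivrMr ?ltr0n // mulrC -ltr_pdivrMr.
Qed.

Section Completeness.
Variables (R : realType) (V : completeNormedModType R[i]).

Lemma cauchy_limit (u : nat -> V) (e : nat -> R) :
  (forall d, 0 < d -> exists n, e n < d) ->
  (forall n m, (n <= m)%N -> rnorm (u n - u m) <= e n) ->
  exists l, forall n, rnorm (u n - l) <= e n.
Proof.
move=> he hu.
have cu : cvg (u @ \oo).
  apply: cauchy_cvg; apply/cauchyP => /= d d0.
  have dE : d = ((complex.Re d)%:C)%C by rewrite RRe_real // gtr0_real.
  have Rd0 : 0 < complex.Re d by rewrite -ltcR -dE.
  have [n hn] := he _ Rd0; exists (u n); exists n => // m /= nm.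
  rewrite -ball_normE /ball_ /= dE -rnorm_lt.
  exact: le_lt_trans (hu _ _ nm) hn.
exists (lim (u @ \oo)) => n; apply/ler_addgt0Pr => d d0.
have /cvgrPdist_lt/(_ (d%:C)%C) := cu; rewrite ltcR => /(_ d0)[N _ hN].
have := hN (maxn n N); rewrite /= leq_maxr => /(_ isT).
rewrite -rnorm_lt => h.
rewrite -(subrKA (u (maxn n N))) (le_trans (rnormD _ _)) // lerD //.
  by apply: hu; exact: leq_maxl.
by rewrite rnormB ltW.
Qed.

End Completeness.

Section CstarNorm.
Variables (R : realType) (A : cstarAlgebra R).
Implicit Types (x y : A).

Lemma rnormM x y : rnorm (x * y) <= rnorm x * rnorm y.
Proof. by rewrite -lecR rmorphM /= -!rnormE; exact: cs_norm_mul_le. Qed.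

Lemma rnorm_starM x : rnorm (star x * x) = rnorm x ^+ 2.
Proof.
by apply: complexI; rewrite rmorphXn /= -!rnormE; exact: (cs_norm_starM x).
Qed.

Lemma starK x : star (star x) = x.
Proof. exact: (@cs_starK R A). Qed.

Lemma starM x y : star (x * y) = star y * star x.
Proof. exact: (@cs_starM R A). Qed.

Lemma star_lin (a : R[i]) x y : star (a *: x + y) = a^* *: star x + star y.
Proof. exact: (@cs_star_conjlin R A). Qed.

Lemma starD x y : star (x + y) = star x + star y.
Proof. by have := star_lin 1 x y; rewrite rmorph1 !scale1r. Qed.

Lemma star0 : star (0 : A) = 0.
Proof.
have := starD 0 0; rewrite addr0 => /(congr1 (fun z => z - star 0)).
by rewrite subrr addrK.
Qed.

Lemma starZ (a : R[i]) x : star (a *: x) = a^* *: star x.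
Proof. by have := star_lin a x 0; rewrite star0 !addr0. Qed.

Lemma starN x : star (- x) = - star x.
Proof. by rewrite -scaleN1r starZ rmorphN1 scaleN1r. Qed.

Lemma star_sum (I : Type) (s : seq I) (f : I -> A) :
  star (\sum_(i <- s) f i) = \sum_(i <- s) star (f i).
Proof.
elim: s => [|i s IH]; first by rewrite !big_nil star0.
by rewrite !big_cons starD IH.
Qed.

Lemma star1 : star (1 : A) = 1.
Proof. by rewrite -[LHS]mulr1 -[X in _ * X]starK -starM mulr1 starK. Qed.

Lemma rnorm_star x : rnorm (star x) = rnorm x.
Proof.
suff le (z : A) : rnorm z <= rnorm (star z).
  by apply: le_anti; rewrite le andbT; have := le (star x); rewrite starK.
have [->|z0] := eqVneq z 0; first by rewrite star0.
have pz : 0 < rnorm z.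
  rewrite lt_neqAle rnorm_ge0 andbT eq_sym; apply/eqP => /rnorm_eq0.
  by move/eqP; rewrite (negPf z0).
by have := rnormM (star z) z; rewrite rnorm_starM expr2 ler_pM2r.
Qed.

Lemma rnorm1_gt0 : 0 < rnorm (1 : A).
Proof.
rewrite lt_neqAle rnorm_ge0 andbT eq_sym; apply/eqP => /rnorm_eq0/eqP.
by rewrite oner_eq0.
Qed.

Lemma rnorm1 : rnorm (1 : A) = 1.
Proof.
have := rnorm_starM 1; rewrite star1 mulr1 expr2 => /esym.
rewrite -[RHS]mulr1; apply: mulfI; rewrite gt_eqF //; exact: rnorm1_gt0.
Qed.

Lemma rnormX_le x n : rnorm (x ^+ n) <= rnorm x ^+ n.
Proof.
elim: n => [|n IH]; first by rewrite expr0 rnorm1.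
rewrite !exprS (le_trans (rnormM _ _)) // ler_wpM2l ?rnorm_ge0 //.
Qed.

(** The inverse is the sum of the Neumann series [1 + x + x^2 + ...]. *)
Lemma left_inverse_1B x : rnorm x < 1 -> exists y, y * (1 - x) = 1.
Proof.
move=> x1; set mu := rnorm x in x1.
have mu0 : 0 <= mu by exact: rnorm_ge0.
have mu01 : 0 <= mu < 1 by rewrite mu0.
have p1 : 0 < 1 - mu by rewrite subr_gt0.
pose u n := \sum_(i < n) x ^+ i; pose e n := mu ^+ n / (1 - mu).
have uE n : u n * (1 - x) = 1 - x ^+ n.
  rewrite /u; elim: n => [|n IH].
    by rewrite big_ord0 mul0r expr0 subrr.
  rewrite big_ord_recr /= mulrDl IH mulrBr mulr1 -exprSr addrA.
  by rewrite subrK.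
have uB n k : rnorm (u n - u (n + k)%N) <= e n * (1 - mu ^+ k).
  elim: k => [|k IH]; first by rewrite addn0 subrr rnorm0 expr0 subrr mulr0.
  rewrite addnS /u big_ord_recr /= -/(u (n + k)%N) opprD addrA.
  rewrite (le_trans (rnormD _ _)) // rnormN.
  apply: le_trans (lerD IH (rnormX_le _ _)) _; rewrite -/mu.
  suff -> : e n * (1 - mu ^+ k) + mu ^+ (n + k) = e n * (1 - mu ^+ k.+1) by [].
  by rewrite /e exprS exprD; field; rewrite gt_eqF.
have eC n : e n = (1 - mu)^-1 * mu ^+ n by rewrite /e mulrC.
have [y hy] : exists y, forall n, rnorm (u n - y) <= e n.
  apply: cauchy_limit => [d d0|n m nm].
    apply: contrapT => /forallNP h; have : d <= 0; last by rewrite leNgt d0.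
    apply: (le_geometric mu01 (C := (1 - mu)^-1)) => n.
    by rewrite -eC leNgt; apply/negP/h.
  rewrite -(subnKC nm) (le_trans (uB _ _)) // ler_piMr //.
    by rewrite /e divr_ge0 ?exprn_ge0 // ltW.
  by rewrite gerBl exprn_ge0.
exists y; apply/eqP; rewrite -subr_eq0; apply/eqP/rnorm_eq0/le_anti.
rewrite rnorm_ge0 andbT.
apply: (le_geometric mu01 (C := (1 - mu)^-1 * rnorm (1 - x) + 1)) => n.
have -> : y * (1 - x) - 1 = (y - u n) * (1 - x) - x ^+ n.
  by rewrite mulrBl uE opprB addrA addrAC addrK.
rewrite (le_trans (rnormD _ _)) // rnormN [leRHS]mulrDl mul1r lerD ?rnormX_le //.
rewrite (le_trans (rnormM _ _)) // mulrAC ler_wpM2r ?rnorm_ge0 // -eC.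
by rewrite rnormB.
Qed.

End CstarNorm.

Section StarRep.
Variables (R : realType) (A : cstarAlgebra R) (H : hilbertSpace R).
Variables (pi : A -> H -> H) (rep : star_rep pi).
Implicit Types (a b : A) (x y : H).

Let lin a : linear (pi a).
Proof. by case: rep => -[h _] _ _ _; case: (h a). Qed.

Lemma repD a x y : pi a (x + y) = pi a x + pi a y.
Proof. by have := lin a 1 x y; rewrite !scale1r. Qed.

Lemma rep0 a : pi a 0 = 0.
Proof.
have := repD a 0 0; rewrite addr0 => /(congr1 (fun z => z - pi a 0)).
by rewrite subrr addrK.
Qed.

Lemma repZ a (c : R[i]) x : pi a (c *: x) = c *: pi a x.
Proof. by have := lin a c x 0; rewrite rep0 !addr0. Qed.

Lemma rep_sum a (I : Type) (s : seq I) (f : I -> H) :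
  pi a (\sum_(i <- s) f i) = \sum_(i <- s) pi a (f i).
Proof.
elim: s => [|i s IH]; first by rewrite !big_nil rep0.
by rewrite !big_cons repD IH.
Qed.

Lemma repDa a b x : pi (a + b) x = pi a x + pi b x.
Proof. by case: rep => -[_ h] _ _ _; have := h 1 a b x; rewrite !scale1r. Qed.

Lemma rep0a x : pi 0 x = 0.
Proof.
have := repDa 0 0 x; rewrite addr0 => /(congr1 (fun z => z - pi 0 x)).
by rewrite subrr addrK.
Qed.

Lemma repZa (c : R[i]) a x : pi (c *: a) x = c *: pi a x.
Proof.
by case: rep => -[_ h] _ _ _; have := h c a 0 x; rewrite rep0a !addr0.
Qed.

Lemma repBa a b x : pi (a - b) x = pi a x - pi b x.
Proof. by rewrite repDa -scaleN1r repZa scaleN1r. Qed.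

Lemma rep_suma (I : Type) (s : seq I) (f : I -> A) x :
  pi (\sum_(i <- s) f i) x = \sum_(i <- s) pi (f i) x.
Proof.
elim: s => [|i s IH]; first by rewrite !big_nil rep0a.
by rewrite !big_cons repDa IH.
Qed.

Lemma repM a b x : pi (a * b) x = pi a (pi b x).
Proof. by case: rep => _ + _ _; apply. Qed.

Lemma rep1 x : pi 1 x = x.
Proof. by case: rep => _ _ + _; apply. Qed.

Lemma rep_dot a x y : hs_dot H (pi a x) y = hs_dot H x (pi (star a) y).
Proof. by case: rep => _ _ _; apply. Qed.

Lemma rep_adj a x y : ip (pi a x) y = ip x (pi (star a) y).
Proof. by rewrite /ip rep_dot. Qed.

Lemma rep_bounded a :
  exists2 B, 1 <= B & forall x, rnorm (pi a x) <= B * rnorm x.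
Proof.
case: rep => -[/(_ a)[_ [M hM]] _] _ _ _; exists (Num.max 1 M) => [|x].
  by rewrite le_max lexx.
by apply: le_trans (hM x) _; rewrite ler_wpM2r ?rnorm_ge0 // le_max lexx orbT.
Qed.

(** If [L > |a|] then [1 - a^* a / L^2] is invertible in the complete algebra [A],
    so its image is bounded below. But
    [|x - pi(a^* a) x / L^2|^2 <= 2 |x|^2 - 2 |pi(a) x|^2 / L^2], so [|pi(a) x|]
    cannot come close to [L |x|]. *)
Lemma improve_bound a (L : R) : rnorm a < L ->
  (forall x, rnorm (pi a x) <= L * rnorm x) ->
  exists2 L', 0 <= L' < L & forall x, rnorm (pi a x) <= L' * rnorm x.
Proof.
move=> aL hL; have L0 : 0 < L by apply: le_lt_trans (rnorm_ge0 a) aL.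
have hL' y : rnorm (pi (star a) y) <= L * rnorm y.
  have [->|ne] := eqVneq (rnorm (pi (star a) y)) 0.
    by rewrite mulr_ge0 ?rnorm_ge0 // ltW.
  rewrite -(@ler_pM2r _ (rnorm (pi (star a) y))); last first.
    by rewrite lt_neqAle eq_sym ne rnorm_ge0.
  rewrite -expr2 -ipxx -rep_adj mulrAC.
  exact: le_trans (ip_le _ _) (ler_wpM2r (rnorm_ge0 _) (hL _)).
pose c : R := L^-2; have c0 : 0 < c by rewrite /c invr_gt0 exprn_gt0.
pose h := (c%:C)%C *: (star a * a).
have [b hb] : exists b, b * (1 - h) = 1.
  apply: left_inverse_1B; rewrite rnormZr gtr0_norm // rnorm_starM mulrC.
  rewrite ltr_pdivrMr ?exprn_gt0 // mul1r.
  by rewrite ltr_pXn2r ?nnegrE ?rnorm_ge0 // ltW.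
have [B B1 hB] := rep_bounded b.
have B0 : 0 < B by apply: lt_le_trans B1.
have B0' := ltW B0; have L0' := ltW L0.
(* |x|^2 <= B^2 (2 |x|^2 - 2 |pi(a) x|^2 / L^2) means |pi(a) x|^2 <= q L^2 |x|^2 *)
pose q := 1 - (2 * B ^+ 2)^-1.
have B2 : 1 <= B ^+ 2 by rewrite exprn_ege1.
have q0 : 0 <= q.
  by rewrite subr_ge0 invf_le1 ?mulr_gt0 ?exprn_gt0 //; lra.
have q1 : q < 1 by rewrite gtrBl invr_gt0 mulr_gt0 // exprn_gt0.
exists (Num.sqrt q * L).
  rewrite mulr_ge0 ?sqrtr_ge0 //= gtr_pMl //.
  by rewrite -[ltRHS]sqrtr1 ltr_sqrt.
move=> x; rewrite -ler_sqr ?nnegrE ?mulr_ge0 ?rnorm_ge0 ?sqrtr_ge0 //.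
rewrite !exprMn sqr_sqrtr //.
have hx : rnorm x ^+ 2 <= B ^+ 2 * rnorm (pi (1 - h) x) ^+ 2.
  rewrite -exprMn ler_sqr ?nnegrE ?mulr_ge0 ?rnorm_ge0 //.
  by rewrite (_ : rnorm x = rnorm (pi b (pi (1 - h) x))) // -repM hb rep1.
move: hx; rewrite repBa rep1 repZa sqr_rnormB ipZr rnormZr exprMn gtr0_norm //.
rewrite repM -rep_adj ipxx.
set t := rnorm (pi a x) ^+ 2; set n := rnorm x ^+ 2.
have h2 : rnorm (pi (star a) (pi a x)) ^+ 2 <= L ^+ 2 * (L ^+ 2 * n).
  rewrite (@le_trans _ _ (L ^+ 2 * t)) //.
    by rewrite -exprMn ler_sqr ?nnegrE ?mulr_ge0 ?rnorm_ge0.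
  rewrite ler_wpM2l ?sqr_ge0 // -exprMn ler_sqr ?nnegrE ?mulr_ge0 ?rnorm_ge0 //.
have h3 : c ^+ 2 * rnorm (pi (star a) (pi a x)) ^+ 2 <= n.
  have -> : n = c ^+ 2 * (L ^+ 2 * (L ^+ 2 * n)).
    by rewrite /c; field; rewrite gt_eqF.
  by rewrite ler_wpM2l ?sqr_ge0.
move=> hx.
have {}hx : n <= B ^+ 2 * (2 * n - 2 * (c * t)).
  by apply: le_trans hx _; rewrite ler_wpM2l ?sqr_ge0 //; lra.
have : c * t <= q * n.
  have {hx} : (2 * B ^+ 2)^-1 * n <= n - c * t.
    rewrite mulrC ler_pdivrMr ?mulr_gt0 ?exprn_gt0 //; lra.
  by rewrite /q mulrBl mul1r; lra.
rewrite {1}/c mulrC ler_pdivrMr ?exprn_gt0 //; lra.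
Qed.

(** The least bound of [pi a] cannot be improved, so it is at most [|a|]. *)
Lemma rep_contractive a x : rnorm (pi a x) <= rnorm a * rnorm x.
Proof.
pose S := [set L : R | 0 <= L /\ forall y, rnorm (pi a y) <= L * rnorm y].
have [B B1 hB] := rep_bounded a.
have S0 : S !=set0 by exists B; split => //; apply: le_trans B1.
have lbS : lbound S 0 by move=> L [].
have hS : has_inf S by split => //; exists 0.
have infS : S (inf S).
  split; first exact: lb_le_inf.
  move=> y; have [y0|ne] := eqVneq (rnorm y) 0.
    by rewrite y0 mulr0 (rnorm_eq0 y0) rep0 rnorm0.
  have yp : 0 < rnorm y by rewrite lt_neqAle eq_sym ne rnorm_ge0.
  rewrite -ler_pdivrMr //; apply: lb_le_inf => // L [_ hL].
  by rewrite ler_pdivrMr.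
have infle : inf S <= rnorm a.
  rewrite leNgt; apply/negP => /(improve_bound)/(_ infS.2)[L' /andP[L0 LS] hL'].
  by move: LS; rewrite ltNge ge_inf //; exists 0.
exact: le_trans (infS.2 x) (ler_wpM2r (rnorm_ge0 _) infle).
Qed.

End StarRep.

(** * Matrix amplifications of representations *)

Section Amplification.
Variables (R : realType) (A : cstarAlgebra R) (H : hilbertSpace R).
Variables (pi : A -> H -> H).

Definition ampl m n (X : 'M[A]_(m, n)) (x : 'I_n -> H) : 'I_m -> H :=
  fun i => \sum_j pi (X i j) (x j).

Definition adjmx m n (X : 'M[A]_(m, n)) : 'M[A]_(n, m) := (map_mx (@star R A) X)^T.

Definition sqnorm n (x : 'I_n -> H) : R := \sum_i rnorm (x i) ^+ 2.

Definition ipsum n (x y : 'I_n -> H) : R := \sum_i ip (x i) (y i).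

Lemma sqnorm_ge0 n (x : 'I_n -> H) : 0 <= sqnorm x.
Proof. by apply: sumr_ge0 => i _; exact: sqr_ge0. Qed.

Lemma ipsumxx n (x : 'I_n -> H) : ipsum x x = sqnorm x.
Proof. by apply: eq_bigr => i _; rewrite ipxx. Qed.

Lemma ipsum_le n (x y : 'I_n -> H) : ipsum x y ^+ 2 <= sqnorm x * sqnorm y.
Proof. exact: ip_sum_le. Qed.

Lemma adjmxK m n (X : 'M[A]_(m, n)) : adjmx (adjmx X) = X.
Proof. by apply/matrixP => i j; rewrite !mxE starK. Qed.

Lemma adjmxM m n p (X : 'M[A]_(m, n)) (Y : 'M[A]_(n, p)) :
  adjmx (X *m Y) = adjmx Y *m adjmx X.
Proof.
apply/matrixP => i j; rewrite !mxE star_sum; apply: eq_bigr => k _.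
by rewrite !mxE starM.
Qed.

Hypothesis rep : star_rep pi.

Lemma amplM m n p (X : 'M[A]_(m, n)) (Y : 'M[A]_(n, p)) (x : 'I_p -> H) :
  ampl (X *m Y) x = ampl X (ampl Y x).
Proof.
apply/funext => i; rewrite /ampl.
under eq_bigr do rewrite mxE (rep_suma rep).
rewrite exchange_big /=; apply: eq_bigr => j _; rewrite (rep_sum rep).
by apply: eq_bigr => k _; rewrite (repM rep).
Qed.

Lemma ampl_adj m n (X : 'M[A]_(m, n)) x y :
  ipsum (ampl X x) y = ipsum x (ampl (adjmx X) y).
Proof.
rewrite /ipsum /ampl; under eq_bigr do rewrite ip_suml.
rewrite exchange_big /=; apply: eq_bigr => j _; rewrite ip_sumr.
by apply: eq_bigr => i _; rewrite (rep_adj rep) !mxE.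
Qed.

(** An operator and its adjoint have the same bounds, by
    [|X^* y|^2 = <y, X X^* y> <= |y| |X X^* y|]. *)
Lemma ampl_adj_bound m n (X : 'M[A]_(m, n)) (B : R) : 0 <= B ->
  (forall x, sqnorm (ampl X x) <= B * sqnorm x) ->
  forall y, sqnorm (ampl (adjmx X) y) <= B * sqnorm y.
Proof.
move=> B0 hB y; set z := ampl _ y.
have [->|ne] := eqVneq (sqnorm z) 0; first by rewrite mulr_ge0 // sqnorm_ge0.
have zp : 0 < sqnorm z by rewrite lt_neqAle eq_sym ne sqnorm_ge0.
rewrite -(ler_pM2r zp) -expr2 -{1}ipsumxx {2}/z -ampl_adj.
apply: le_trans (ipsum_le _ _) _.
by rewrite mulrAC ler_wpM2r ?sqnorm_ge0.
Qed.

Lemma ampl_entry m n (X : 'M[A]_(m, n)) (B : R) i j (x : H) :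
  (forall y, sqnorm (ampl X y) <= B * sqnorm y) ->
  rnorm (pi (X i j) x) ^+ 2 <= B * rnorm x ^+ 2.
Proof.
move=> hB; have := hB (fun k => if k == j then x else 0).
rewrite {2}/sqnorm (bigD1 j) //= eqxx big1 => [|k /negPf ->]; last first.
  by rewrite rnorm0 expr0n.
rewrite addr0; apply: le_trans; rewrite /sqnorm (bigD1 i) //= {1}/ampl.
rewrite (bigD1 j) //= eqxx big1 => [|k /negPf ->]; last by rewrite (rep0 rep).
by rewrite addr0 lerDl; apply: sumr_ge0 => k _; exact: sqr_ge0.
Qed.

End Amplification.

Section Domination.
Variables (R : realType) (A : cstarAlgebra R) (H K : hilbertSpace R).
Variables (pi : A -> H -> H) (sigma : A -> K -> K).
Variables (faithful : faithful_rep pi) (rep : star_rep sigma).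

Let rep_pi : star_rep pi := faithful.1.

(** [D^(2^k)], by repeated squaring. *)
Fixpoint pow2mx n (D : 'M[A]_n) (k : nat) : 'M[A]_n :=
  if k is k'.+1 then pow2mx D k' *m pow2mx D k' else D.

Lemma pow2mx_adj n (D : 'M[A]_n) k : adjmx D = D -> adjmx (pow2mx D k) = pow2mx D k.
Proof. by move=> sD; elim: k => //= k IH; rewrite adjmxM IH. Qed.

Lemma pow2mx_bound n (D : 'M[A]_n) (B : R) k : 0 <= B ->
  (forall x, sqnorm (ampl pi D x) <= B * sqnorm x) ->
  forall x, sqnorm (ampl pi (pow2mx D k) x) <= B ^+ (2 ^ k) * sqnorm x.
Proof.
move=> B0 hB; elim: k => [|k IH] x /=; first by rewrite expr1.
rewrite (amplM rep_pi) (le_trans (IH _)) // expnS mul2n -addnn exprD -mulrA.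
by rewrite ler_wpM2l ?exprn_ge0.
Qed.

(** The entries of a matrix are dominated in norm by their images under [pi], so
    the amplification of [sigma] is bounded by that of [pi] up to the factor
    [n^2]. *)
Lemma ampl_crude_bound n (X : 'M[A]_n) (B : R) : 0 <= B ->
  (forall x, sqnorm (ampl pi X x) <= B * sqnorm x) ->
  forall x, sqnorm (ampl sigma X x) <= n%:R ^+ 2 * B * sqnorm x.
Proof.
move=> B0 hB x.
have entry i j : rnorm (X i j) ^+ 2 <= B.
  rewrite -(sqr_sqrtr B0) ler_sqr ?nnegrE ?rnorm_ge0 ?sqrtr_ge0 //.
  apply/(faithful.2 _ _ (sqrtr_ge0 B)) => y.
  rewrite -ler_sqr ?nnegrE ?mulr_ge0 ?rnorm_ge0 ?sqrtr_ge0 //.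
  by rewrite exprMn sqr_sqrtr //; exact: (ampl_entry rep_pi).
rewrite {1}/sqnorm /ampl.
apply: (@le_trans _ _ (\sum_(i < n) n%:R * (B * sqnorm x))).
  apply: ler_sum => i _; apply: le_trans (sqr_rnorm_sum_le _ _) _.
  rewrite /index_enum -enumT size_enum_ord ler_wpM2l // /sqnorm mulr_sumr.
  rewrite enumT; apply: ler_sum => j _.
  apply: (@le_trans _ _ (rnorm (X i j) ^+ 2 * rnorm (x j) ^+ 2)).
    rewrite -exprMn ler_sqr ?nnegrE ?mulr_ge0 ?rnorm_ge0 //.
    exact: rep_contractive.
  by rewrite ler_wpM2r ?sqr_ge0.
by rewrite sumr_const card_ord -[leLHS]mulr_natl expr2 !mulrA.
Qed.

(** A faithful representation dominates any other one on matrices. The factor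
    [n^2] of the crude bound disappears by applying that bound to the powers
    [(C^* C)^(2^k)] and taking roots. *)
Lemma faithful_dominates m n (C : 'M[A]_(m, n)) (B : R) : 0 <= B ->
  (forall x, sqnorm (ampl pi C x) <= B * sqnorm x) ->
  forall x, sqnorm (ampl sigma C x) <= B * sqnorm x.
Proof.
move=> B0 hB x; pose D := adjmx C *m C; pose Dk := pow2mx D.
have sD : adjmx D = D by rewrite /D adjmxM adjmxK.
have hD y : sqnorm (ampl pi D y) <= B ^+ 2 * sqnorm y.
  rewrite /D (amplM rep_pi) (le_trans (ampl_adj_bound rep_pi B0 hB _)) //.
  by rewrite expr2 -mulrA ler_wpM2l.
set N := sqnorm x; set t := sqnorm _.
have N0 : 0 <= N := sqnorm_ge0 _; have t0 : 0 <= t := sqnorm_ge0 _.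
have key k : ipsum x (ampl sigma (Dk k.+1) x) = sqnorm (ampl sigma (Dk k) x).
  rewrite [Dk k.+1]/(Dk k *m Dk k) (amplM rep) -{1}[Dk k](pow2mx_adj k sD).
  by rewrite -(ampl_adj rep) ipsumxx.
have sqD k : t ^+ (2 ^ k) <= N ^+ (2 ^ k).-1 * ipsum x (ampl sigma (Dk k) x).
  elim: k => [|k IH].
    by rewrite expr1 expr0 mul1r /= /D (amplM rep) -(ampl_adj rep) ipsumxx.
  rewrite expnS mul2n -addnn exprD -expr2.
  have p0 : 0 <= t ^+ (2 ^ k) by rewrite exprn_ge0.
  apply: le_trans (_ : (N ^+ (2 ^ k).-1 * ipsum x (ampl sigma (Dk k) x)) ^+ 2 <= _).
    by rewrite ler_sqr ?nnegrE //; apply: le_trans IH.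
  rewrite exprMn (_ : (_ + _).-1 = ((2 ^ k).-1 + (2 ^ k).-1).+1)%N; last first.
    by case: (2 ^ k)%N (expn_gt0 2 k) => //= j _; rewrite addnS.
  rewrite [in leRHS]exprSr [in leRHS]exprD -expr2 -mulrA ler_wpM2l ?sqr_ge0 // key.
  exact: ipsum_le.
have bound k : t ^+ (2 ^ k.+1) <= n%:R ^+ 2 * (B * N) ^+ (2 ^ k.+1).
  apply: le_trans (sqD k.+1) _.
  rewrite key.
  have B2 : 0 <= B ^+ 2 by exact: sqr_ge0.
  have := ampl_crude_bound (exprn_ge0 _ B2) (pow2mx_bound k B2 hD) x.
  rewrite -exprM -expnS -/N => h.
  apply: le_trans (ler_wpM2l (exprn_ge0 _ N0) h) _.
  have -> : (B * N) ^+ (2 ^ k.+1) = B ^+ (2 ^ k.+1) * (N ^+ (2 ^ k.+1).-1 * N).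
    by rewrite exprMn -exprSr prednK ?expn_gt0.
  by rewrite mulrCA -!mulrA.
rewrite leNgt; apply/negP => lt.
have t1 : 0 < t by apply: le_lt_trans lt; rewrite mulr_ge0.
have mu01 : 0 <= (B * N) / t < 1.
  by rewrite divr_ge0 ?mulr_ge0 //= ltr_pdivrMr // mul1r.
suff : (1 : R) <= 0 by rewrite ler10.
apply: (le_geometric mu01 (C := n%:R ^+ 2)) => k.
apply: (@le_trans _ _ (n%:R ^+ 2 * (B * N / t) ^+ (2 ^ k.+1))).
  by rewrite expr_div_n mulrA ler_pdivlMr ?exprn_gt0 // mul1r.
have /andP[mu0 mu1] := mu01; rewrite ler_wpM2l ?sqr_ge0 //.
apply: ler_wiXn2l => //; first exact: ltW.
by rewrite ltnW // ltnW // ltn_expl.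
Qed.

End Domination.

(** * From a faithful representation to an arbitrary one *)

Section UnconditionalSums.
Variables (R : realType) (T : choiceType) (f : T -> R).

Lemma sum_le_esum (s : seq T) : uniq s ->
  ((\sum_(x <- s) f x)%:E <= \esum_(x in [set: T]) (f x)%:E)%E.
Proof.
move=> us; apply: esum_ge; exists [set` s]; first by split.
by rewrite -sumEFin (fsbig_seq _ _ us).
Qed.

Lemma esum_le_bound (c : R) : (forall s, uniq s -> \sum_(x <- s) f x <= c) ->
  (\esum_(x in [set: T]) (f x)%:E <= c%:E)%E.
Proof.
move=> h; apply: ge_ereal_sup => _ /= [X [finX _]] <-.
by rewrite fsbig_finite //= sumEFin lee_fin; apply: h.
Qed.

Lemma esum_support (s : seq T) : (forall x, 0 <= f x) -> uniq s ->
  (forall x, x \notin s -> f x = 0) ->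
  (\esum_(x in [set: T]) (f x)%:E)%E = (\sum_(x <- s) f x)%:E.
Proof.
move=> f0 us fs; apply/le_anti; rewrite sum_le_esum // andbT.
apply: esum_le_bound => t ut.
rewrite (bigID (mem s)) /= [X in _ + X]big1 ?addr0 => [|x /fs //].
rewrite [leRHS](bigID (mem t)) /= -[leLHS]addr0 lerD ?sumr_ge0 //.
rewrite -[leLHS]big_filter -[leRHS]big_filter.
rewrite (perm_big [seq x <- s | x \in t]) //.
apply: uniq_perm; rewrite ?filter_uniq // => x.
by rewrite !mem_filter andbC.
Qed.

End UnconditionalSums.

Section ReducedTransfer.
Variables (R : realType) (A : cstarAlgebra R) (G : groupType).
Variables (beta : G -> A -> A) (s : seq (A * G)).

(** The block of the regular representation of [s] that sends families supported
    in [F] to their images restricted to [F']. *)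
Definition regular_mx (F F' : seq G) : 'M[A]_(size F', size F) :=
  \matrix_(i, j) \sum_(p <- s | (p.2^-1 * tnth (in_tuple F') i)%g ==
      tnth (in_tuple F) j) beta (tnth (in_tuple F') i)^-1%g p.1.

Lemma regular_mxE (H : hilbertSpace R) (pi : A -> H -> H) (F F' : seq G)
    (eta : G -> H) i : star_rep pi -> uniq F -> (forall g, g \notin F -> eta g = 0) ->
  ampl pi (regular_mx F F') (fun j => eta (tnth (in_tuple F) j)) i =
  \sum_(p <- s) induced_rep beta pi p.1 (left_translation p.2 eta)
    (tnth (in_tuple F') i).
Proof.
move=> rep uF supp; rewrite /ampl /induced_rep /left_translation.
set x := tnth _ i.
under eq_bigr do rewrite mxE -/x big_mkcond (rep_suma rep).
rewrite exchange_big /=; apply: eq_bigr => p _; set y := (_ * x)%g.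
pose c := beta x^-1%g p.1.
transitivity (\sum_(j < size F | y == tnth (in_tuple F) j) pi c (eta y)).
  rewrite [RHS]big_mkcond; apply: eq_bigr => j _.
  by case: eqP => [->//|_]; rewrite (rep0a rep).
have [yF|yF] := boolP (y \in F); last by rewrite supp // (rep0 rep) big1.
have ly : (index y F < size F)%N by rewrite index_mem.
rewrite (big_pred1 (Ordinal ly)) // => j.
rewrite (tnth_nth 1%g) /= -[X in X == _](nth_index 1%g yF) nth_uniq //.
exact: eq_sym.
Qed.

(** On finitely supported vectors the regular representation induced by any
    representation of [A] is given by finite matrices over [A], for which a faithful
    representation dominates every other one. *)
Lemma reduced_norm_transfer (H K : hilbertSpace R) (pi : A -> H -> H)
    (sigma : A -> K -> K) (M : R) (F F' : seq G) (eta : G -> K) :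
  faithful_rep pi -> star_rep sigma -> reduced_norm_le beta pi s M ->
  uniq F -> uniq F' -> (forall g, g \notin F -> eta g = 0) ->
  \sum_(x <- F') rnorm (\sum_(p <- s)
      induced_rep beta sigma p.1 (left_translation p.2 eta) x) ^+ 2 <=
  M ^+ 2 * \sum_(x <- F) rnorm (eta x) ^+ 2.
Proof.
move=> faithful rep hM uF uF' supp.
rewrite big_tnth [in leRHS]big_tnth.
under eq_bigr do rewrite -(regular_mxE _ rep uF supp).
suff h y : sqnorm (ampl pi (regular_mx F F') y) <= M ^+ 2 * sqnorm y.
  exact: (faithful_dominates faithful rep (sqr_ge0 M) h).
pose z g := if insub (index g F) is Some j then y j else 0.
have zF j : z (tnth (in_tuple F) j) = y j.
  rewrite /z (tnth_nth 1%g) /= index_uniq // insubT //= => lj.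
  by congr y; apply: val_inj.
have z0 g : g \notin F -> z g = 0.
  by move=> gF; rewrite /z memNindex // insubF // ltnn.
have -> : y = fun j => z (tnth (in_tuple F) j) by apply/funext => j; rewrite zF.
have sz : (l2_sqnorm z = (\sum_(x <- F) rnorm (z x) ^+ 2)%:E)%E.
  apply: esum_support => // [x|x xF]; first exact: sqr_ge0.
  by rewrite z0 // rnorm0 expr0n.
have := hM z; rewrite sz ltry -EFinM => /(_ isT) h.
rewrite /sqnorm; under eq_bigr do rewrite (regular_mxE _ faithful.1) //.
rewrite -[in leRHS](big_tnth _ _ F xpredT (fun x => rnorm (z x) ^+ 2)).
rewrite -(big_tnth _ _ F' xpredT (fun x =>
  rnorm (\sum_(p <- s) induced_rep beta pi p.1 (left_translation p.2 z) x) ^+ 2)).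
rewrite -lee_fin; apply: le_trans h.
exact: sum_le_esum.
Qed.

End ReducedTransfer.

(** * Sublinear functionals *)

Section HahnBanach.
Variables (R : realType) (V : lmodType R) (D : set V).
Hypotheses (DD : forall x y, D x -> D y -> D (x + y))
           (DZ : forall (r : R) x, D x -> D (r *: x)).

Definition sublinear (q : V -> R) : Prop :=
  (forall x y, D x -> D y -> q (x + y) <= q x + q y) /\
  (forall (r : R) x, 0 < r -> D x -> q (r *: x) <= r * q x).

Let DN x : D x -> D (- x).
Proof. by rewrite -scaleN1r; exact: DZ. Qed.

Let D0 x : D x -> D 0.
Proof. by rewrite -(scale0r x); exact: DZ. Qed.

Lemma sublinear0 q x : sublinear q -> D x -> q 0 = 0.
Proof.
move=> [_ qZ] /D0 D00; have h2 := qZ 2 0 ltac:(lra) D00.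
have hh := qZ 2^-1 0 ltac:(lra) D00.
by move: h2 hh; rewrite !scaler0 => h2 hh; lra.
Qed.

Lemma sublinearZ q (t : R) x : sublinear q -> D x -> 0 <= t ->
  t * q x <= q (t *: x).
Proof.
move=> sq Dx; rewrite le_eqVlt => /predU1P[<-|t0].
  by rewrite scale0r mul0r (sublinear0 sq Dx).
have := sq.2 t^-1 _ _ (DZ t Dx); rewrite invr_gt0 => /(_ t0).
by rewrite scalerA mulVf ?gt_eqF // scale1r mulrC ler_pdivlMr // mulrC.
Qed.

Lemma sublinear_ge q x : sublinear q -> D x -> - q (- x) <= q x.
Proof.
move=> sq Dx; rewrite lerNl -subr_ge0 opprK addrC -(sublinear0 sq Dx).
by rewrite -(subrr x); exact: sq.1 (DN Dx).
Qed.

(** A sublinear functional [p] that is minimal on [D] is additive there: the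
    functional [x |-> inf_(t >= 0) (p (x + t y) - t p y)] is sublinear and below
    [p], and its value at [- y] is at most [- p y]. *)
Lemma minimal_sublinear_additive (p : V -> R) : sublinear p ->
  (forall q, sublinear q -> (forall x, D x -> q x <= p x) ->
    forall x, D x -> p x <= q x) ->
  forall x y, D x -> D y -> p (x + y) = p x + p y.
Proof.
move=> sp pmin x y Dx Dy.
pose E z := [set u | exists2 t : R, 0 <= t & u = p (z + t *: y) - t * p y].
pose q z := inf (E z).
have lbE z : D z -> lbound (E z) (- p (- z)).
  move=> Dz _ [t t0 ->]; have h := sublinearZ sp Dy t0.
  have : p (t *: y) <= p (z + t *: y) + p (- z).
    by have := sp.1 _ _ (DD Dz (DZ t Dy)) (DN Dz); rewrite addrAC subrr add0r.
  by move=> h'; lra.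
have infE z : D z -> has_inf (E z).
  move=> Dz; split; last by exists (- p (- z)); exact: lbE.
  by exists (p (z + 0 *: y) - 0 * p y), 0.
have q_le z (t : R) : D z -> 0 <= t -> q z <= p (z + t *: y) - t * p y.
  by move=> Dz t0; apply: ge_inf; [case: (infE z Dz)|exists t].
have ge_q z (c : R) : D z -> (forall t : R, 0 <= t -> c <= p (z + t *: y) - t * p y) ->
    c <= q z.
  move=> Dz hc; apply: lb_le_inf; first by case: (infE z Dz).
  by move=> _ [t t0 ->]; exact: hc.
have sq : sublinear q.
  split=> [z z' Dz Dz'|r z r0 Dz].
    rewrite -lerBlDr; apply: (@ge_q) => // t t0.
    rewrite lerBlDr -lerBlDl; apply: (@ge_q) => // t' t'0.
    have := q_le (z + z') (t + t') (DD Dz Dz') (addr_ge0 t0 t'0).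
    have := sp.1 _ _ (DD Dz (DZ t Dy)) (DD Dz' (DZ t' Dy)).
    by rewrite addrACA scalerDl => h h'; lra.
  rewrite -ler_pdivrMl //; apply: (@ge_q) => // t t0.
  rewrite ler_pdivrMl //.
  have := q_le (r *: z) (r * t) (DZ r Dz) (mulr_ge0 (ltW r0) t0).
  have := sp.2 r _ r0 (DD Dz (DZ t Dy)).
  by rewrite scalerDr scalerA => h h'; lra.
have le_qp z : D z -> q z <= p z.
  by move=> Dz; have := q_le z 0 Dz (lexx 0); rewrite scale0r addr0 mul0r subr0.
have pNy : p (- y) <= - p y.
  apply: le_trans (pmin _ sq le_qp _ (DN Dy)) _.
  have := q_le (- y) 1 (DN Dy) ler01.
  by rewrite scale1r addNr (sublinear0 sp Dy) mul1r sub0r.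
apply/le_anti; rewrite sp.1 //=.
have := sp.1 _ _ (DD Dx Dy) (DN Dy); rewrite addrK => h.
by lra.
Qed.

(** The Hahn-Banach theorem on a subspace [D]. Zorn's lemma provides a minimal
    sublinear functional below [q]: the infimum of a chain is again sublinear. *)
Theorem additive_minorant (q : V -> R) : sublinear q ->
  exists phi : V -> R, (forall x, D x -> phi x <= q x) /\
    (forall x y, D x -> D y -> phi (x + y) = phi x + phi y).
Proof.
move=> sq.
pose T := {p : V -> R | sublinear p /\ forall x, D x -> p x <= q x}.
pose le (p p' : T) := `[< forall x, D x -> sval p' x <= sval p x >].
have leP p p' : le p p' -> forall x, D x -> sval p' x <= sval p x by move/asboolP.
have q_T : sublinear q /\ forall x, D x -> q x <= q x by split.
have [||A totA|p pmin] := @ZL_preorder T (exist _ q q_T) le.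
- by move=> p; apply/asboolP.
- move=> p p' p'' /leP h /leP h'; apply/asboolP => x Dx.
  exact: le_trans (h' x Dx) (h x Dx).
- have [[p0 Ap0]|A0] := pselect (exists p, A p); last first.
    by exists (exist _ q q_T) => p Ap; case: A0; exists p.
  pose E x := [set sval p x | p in A].
  pose s x := inf (E x).
  have infE x : D x -> has_inf (E x).
    move=> Dx; split; first by exists (sval p0 x); exists p0.
    exists (- q (- x)) => _ [p Ap <-]; have [sp pq] := svalP p.
    by apply: le_trans (sublinear_ge sp Dx); rewrite lerN2 pq //; exact: DN.
  have les p x : A p -> D x -> s x <= sval p x.
    by move=> Ap Dx; apply: ge_inf; [case: (infE x Dx)|exists p].
  have ges x (c : R) : D x -> (forall p, A p -> c <= sval p x) -> c <= s x.
    move=> Dx h; apply: lb_le_inf; first by case: (infE x Dx).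
    by move=> _ [p Ap <-]; exact: h.
  have ss : sublinear s.
    split=> [x y Dx Dy|r x r0 Dx].
      rewrite -lerBlDr; apply: (@ges) => // p Ap.
      rewrite lerBlDr -lerBlDl; apply: (@ges) => // p' Ap'; rewrite lerBlDl.
      have [sp _] := svalP p; have [sp' _] := svalP p'.
      have Dxy := DD Dx Dy.
      have [/leP h|/leP h] := totA _ _ Ap Ap'.
        rewrite (le_trans (les _ _ Ap' Dxy)) // (le_trans (sp'.1 _ _ Dx Dy)) //.
        by rewrite lerD2r h.
      rewrite (le_trans (les _ _ Ap Dxy)) // (le_trans (sp.1 _ _ Dx Dy)) //.
      by rewrite lerD2l h.
    rewrite -ler_pdivrMl //; apply: (@ges) => // p Ap; rewrite ler_pdivrMl //.
    have [sp _] := svalP p.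
    exact: le_trans (les _ _ Ap (DZ r Dx)) (sp.2 _ _ r0 Dx).
  have sT : sublinear s /\ forall x, D x -> s x <= q x.
    split=> // x Dx; apply: le_trans (les _ _ Ap0 Dx) _.
    by case: (svalP p0) => _; exact.
  by exists (exist _ s sT) => p Ap; apply/asboolP => x Dx; exact: les.
- have [sp pq] := svalP p; exists (sval p); split=> //.
  apply: minimal_sublinear_additive => // r sr rp.
  have rT : sublinear r /\ forall x, D x -> r x <= q x.
    by split=> // x Dx; exact: le_trans (rp x Dx) (pq x Dx).
  by apply: (leP (exist _ r rT)); apply: pmin; apply/asboolP.
Qed.

End HahnBanach.

(** * Almost invariant probability vectors *)

Section L1Norm.
Variables (R : realType) (X : choiceType).
Implicit Types (w f : X -> R^o).

Definition finitely_supported w : Prop :=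
  exists F : seq X, forall x, x \notin F -> w x = 0.

(** The value is 0 when [w] is not summable. *)
Definition l1norm w : R := fine (\esum_(x in [set: X]) (`|w x|)%:E)%E.

Lemma l1normE w (F : seq X) : uniq F -> (forall x, x \notin F -> w x = 0) ->
  l1norm w = \sum_(x <- F) `|w x|.
Proof.
move=> uF supp; rewrite /l1norm (esum_support _ uF) // => x xF.
by rewrite supp // normr0.
Qed.

Lemma common_support w f : finitely_supported w -> finitely_supported f ->
  exists2 F : seq X, uniq F &
    forall x, x \notin F -> w x = 0 /\ f x = 0.
Proof.
move=> [F hF] [F' hF']; exists (undup (F ++ F')); first exact: undup_uniq.
move=> x; rewrite mem_undup mem_cat negb_or => /andP[xF xF'].
by rewrite hF ?hF'.
Qed.

Lemma finitely_supportedD w f : finitely_supported w -> finitely_supported f ->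
  finitely_supported (w + f).
Proof.
move=> hw hf; have [F _ hF] := common_support hw hf.
by exists F => x /hF[w0 f0]; rewrite fctE w0 f0 addr0.
Qed.

Lemma finitely_supportedZ (r : R) w : finitely_supported w ->
  finitely_supported (r *: w).
Proof. by move=> [F hF]; exists F => x /hF w0; rewrite fctE w0 scaler0. Qed.

Lemma finitely_supported0 : finitely_supported 0.
Proof. by exists [::]. Qed.

Lemma finitely_supported_sum (I : Type) (s : seq I) (h : I -> X -> R^o) :
  (forall i, finitely_supported (h i)) -> finitely_supported (\sum_(i <- s) h i).
Proof.
move=> hh; elim/big_ind : _ => //; first exact: finitely_supported0.
exact: finitely_supportedD.
Qed.

Lemma l1norm0 : l1norm 0 = 0.
Proof. by rewrite (@l1normE _ [::]) // big_nil. Qed.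

Lemma l1norm_ge0 w : 0 <= l1norm w.
Proof. by apply/fine_ge0/esum_ge0 => x _; rewrite lee_fin. Qed.

Lemma l1normD w f : finitely_supported w -> finitely_supported f ->
  l1norm (w + f) <= l1norm w + l1norm f.
Proof.
move=> hw hf; have [F uF hF] := common_support hw hf.
rewrite !(@l1normE _ F) // => [|x /hF[]//|x /hF[]//|x /hF[w0 f0]].
  by rewrite -big_split /=; apply: ler_sum => x _; exact: ler_normD.
by rewrite fctE w0 f0 addr0.
Qed.

Lemma l1normZ (r : R) w : finitely_supported w -> l1norm (r *: w) = `|r| * l1norm w.
Proof.
move=> [F' hF']; pose F := undup F'.
have hF x : x \notin F -> w x = 0 by rewrite mem_undup; exact: hF'.
rewrite !(@l1normE _ F) ?undup_uniq // => [|x /hF w0]; last first.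
  by rewrite fctE w0 scaler0.
by rewrite mulr_sumr; apply: eq_bigr => x _; rewrite fctE -normrM.
Qed.

Lemma l1norm_nonnegD w f : (forall x, 0 <= w x) -> (forall x, 0 <= f x) ->
  finitely_supported w -> finitely_supported f ->
  l1norm (w + f) = l1norm w + l1norm f.
Proof.
move=> w0 f0 hw hf; have [F uF hF] := common_support hw hf.
rewrite !(@l1normE _ F) // => [|x /hF[]//|x /hF[]//|x /hF[e e']].
  rewrite -big_split /=; apply: eq_bigr => x _.
  by rewrite fctE !ger0_norm ?addr_ge0.
by rewrite fctE e e' addr0.
Qed.

Definition point_mass (x : X) : X -> R^o := fun y => (y == x)%:R.

Lemma point_mass_supported x : finitely_supported (point_mass x).
Proof. by exists [:: x] => y; rewrite inE /point_mass => /negPf ->. Qed.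

Lemma l1norm_point_mass x : l1norm (point_mass x) = 1.
Proof.
rewrite (@l1normE _ [:: x]) // => [|y].
  by rewrite big_seq1 /point_mass eqxx normr1.
by rewrite inE /point_mass => /negPf ->.
Qed.

End L1Norm.

Section Mean.
Variables (R : realType) (G : groupType) (m : (G -> R) -> R).
Hypothesis mlin : forall (a : R) (f h : G -> R), bounded_real_fun f ->
  bounded_real_fun h -> m (fun g => a * f g + h g) = a * m f + m h.
Hypothesis mpos : forall f, bounded_real_fun f -> (forall g, 0 <= f g) -> 0 <= m f.
Hypothesis m1 : m (fun=> 1) = 1.
Hypothesis minv : forall f (h : G), bounded_real_fun f ->
  m (fun g => f (h * g)%g) = m f.

Lemma bounded_cst (c : R) : bounded_real_fun (fun _ : G => c).
Proof. by exists `|c|. Qed.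

Lemma bounded_lin (a : R) (f h : G -> R) : bounded_real_fun f ->
  bounded_real_fun h -> bounded_real_fun (fun g => a * f g + h g).
Proof.
move=> [M hM] [N hN]; exists (`|a| * M + N) => g.
by rewrite (le_trans (ler_normD _ _)) // normrM lerD // ler_wpM2l.
Qed.

Lemma bounded_translate (f : G -> R) (h : G) : bounded_real_fun f ->
  bounded_real_fun (fun g => f (h * g)%g).
Proof. by move=> [M hM]; exists M => g. Qed.

Lemma mean0 : m (fun=> 0) = 0.
Proof.
have := mlin (-1) (bounded_cst 1) (bounded_cst 1).
by rewrite m1 mulN1r addNr.
Qed.

(** By left invariance the two terms of each summand have the same mean. *)
Lemma mean_coboundary (s : seq G) (Phi : G -> G -> R) :
  (forall h, bounded_real_fun (Phi h)) ->
  bounded_real_fun (fun x => \sum_(h <- s) (Phi h (h * x)%g - Phi h x)) /\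
  m (fun x => \sum_(h <- s) (Phi h (h * x)%g - Phi h x)) = 0.
Proof.
move=> hPhi; elim: s => [|h s [bs ms]].
  by under eq_fun do rewrite big_nil; split; [exact: bounded_cst|exact: mean0].
pose f := fun x => 1 * Phi h (h * x)%g +
  (- 1 * Phi h x + \sum_(k <- s) (Phi k (k * x)%g - Phi k x)).
have -> : (fun x => \sum_(k <- h :: s) (Phi k (k * x)%g - Phi k x)) = f.
  by apply/funext => x; rewrite /f big_cons mul1r mulN1r addrA.
have b1 := bounded_translate h (hPhi h).
have b2 := bounded_lin (-1) (hPhi h) bs.
split; first exact: bounded_lin.
by rewrite /f mlin // mlin // minv // ms; ring.
Qed.

Lemma mean_ge (c : R) (f : G -> R) : bounded_real_fun f ->
  (forall x, c <= f x) -> c <= m f.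
Proof.
move=> bf hc; have e := mlin (- c) (bounded_cst 1) bf.
have h : 0 <= m (fun g => - c * 1 + f g).
  apply: mpos => [|g]; first exact: bounded_lin (bounded_cst 1) bf.
  by rewrite mulr1 addrC subr_ge0.
by move: h; rewrite e m1 mulr1 addrC subr_ge0.
Qed.

(** The family of the differences between [f] and its translates by the elements of
    [E], as one function on [G * G] that vanishes off [E * G]; its l^1 norm is the
    sum of the l^1 norms of these differences. *)
Definition translation_defect (E : seq G) (f : G -> R^o) : G * G -> R^o :=
  fun z => if z.1 \in E then f (z.1^-1 * z.2)%g - f z.2 else 0.

Lemma translation_defect_supported E f : finitely_supported f ->
  finitely_supported (translation_defect E f).
Proof.
move=> [F hF]; exists [seq (h, x) | h <- E, x <- F ++ [seq (k * y)%g | k <- E, y <- F]].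
move=> [h x]; rewrite /translation_defect /=; case: ifP => // hE hn.
have hx : x \notin F ++ [seq (k * y)%g | k <- E, y <- F].
  by apply: contra hn => xF; apply: allpairs_f.
move: hx; rewrite mem_cat negb_or => /andP[xF xEF].
rewrite [f x]hF // hF ?subrr //; apply: contra xEF => hxF.
by rewrite -[x](mulVKg h); apply: allpairs_f.
Qed.

Lemma translation_defectD E f h : translation_defect E (f + h) =
  translation_defect E f + translation_defect E h.
Proof.
apply/funext => z.
rewrite -[RHS]/(translation_defect E f z + translation_defect E h z).
rewrite /translation_defect; case: ifP => _; last by rewrite addr0.
by rewrite !fctE opprD addrACA.
Qed.

Lemma translation_defectZ E (r : R) f : translation_defect E (r *: f) =
  r *: translation_defect E f.
Proof.
apply/funext => z; rewrite -[RHS]/(r *: translation_defect E f z).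
rewrite /translation_defect; case: ifP => _; last by rewrite scaler0.
by rewrite !fctE scalerBr.
Qed.

Lemma translation_defect_point_mass E x : uniq E ->
  translation_defect E (point_mass R x) =
  \sum_(h <- E) (point_mass R (h, h * x)%g - point_mass R (h, x)).
Proof.
move=> uE; apply/funext => -[k y]; rewrite fct_sumE /translation_defect /=.
have term h : (point_mass R (h, (h * x)%g) - point_mass R (h, x)) (k, y) =
    if k == h then (k^-1 * y == x)%g%:R - (y == x)%:R else 0.
  rewrite -[LHS]/(point_mass R (h, (h * x)%g) (k, y) - point_mass R (h, x) (k, y)).
  rewrite /point_mass !xpair_eqE; case: eqP => [->|_]; last by rewrite /= subrr.
  by rewrite /= -[in RHS](inj_eq (mulgI h) (h^-1 * y)%g x) mulVKg.
under eq_bigr do rewrite term.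
case: ifP => kE; last first.
  rewrite big_seq big1 // => h hE; case: eqP => // kh.
  by rewrite kh hE in kE.
rewrite (bigD1_seq k) //= eqxx big1 ?addr0 // => h hk.
by rewrite eq_sym (negPf hk).
Qed.

(** Day's argument. Suppose that the l^1 norm of the defect of every nonnegative [f]
    is at least [delta] times the norm of [f]. Then
    [q w = inf_f (|w + defect f| - delta |f|)] is a finite sublinear functional with
    [q w <= |w|] and [q (- defect f) <= - delta |f|]. An additive [phi <= q] takes
    values of modulus at most 1 on point masses, hence defines bounded functions
    [Phi h] on [G], and evaluating it at the defect of the point mass at [x] gives
    [sum_h (Phi h (h x) - Phi h x) >= delta]. The mean of the left-hand side is 0. *)
Lemma defect_not_bounded_below (E : seq G) (delta : R) : uniq E -> 0 < delta ->
  exists f : G -> R^o, [/\ forall x, 0 <= f x, finitely_supported f &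
    l1norm (translation_defect E f) < delta * l1norm f].
Proof.
move=> uE d0; apply: contrapT => /forallNP hno.
have low f : (forall x, 0 <= f x) -> finitely_supported f ->
    delta * l1norm f <= l1norm (translation_defect E f).
  by move=> f0 sf; rewrite leNgt; apply/negP => lt; apply: (hno f).
pose V := (G * G -> R^o)%type; pose D : set V := @finitely_supported R (G * G)%type.
have DD x y : D x -> D y -> D (x + y) by exact: finitely_supportedD.
have DZ (r : R) x : D x -> D (r *: x) by exact: finitely_supportedZ.
pose nonneg f := (forall x : G, (0 : R) <= f x) /\ @finitely_supported R G f.
have Td f : nonneg f -> D (translation_defect E f).
  by case=> _; exact: translation_defect_supported.
pose P (w : V) f := l1norm (w + translation_defect E f) - delta * l1norm f.
pose Q w := [set P w f | f in nonneg]; pose q w := inf (Q w).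
have nn0 : nonneg 0 by split; [|exact: finitely_supported0].
have DN w : D w -> D (- w) by move=> Dw; rewrite -scaleN1r; exact: DZ.
have infQ w : D w -> has_inf (Q w).
  move=> Dw; split; first by exists (P w 0), 0.
  exists (- l1norm (- w)) => _ [f nf <-]; rewrite /P.
  have := low f nf.1 nf.2.
  have := l1normD (DD _ _ Dw (Td f nf)) (DN _ Dw).
  by rewrite addrAC subrr add0r => h h'; lra.
have q_le w f : D w -> nonneg f -> q w <= P w f.
  by move=> Dw nf; apply: ge_inf; [case: (infQ w Dw)|exists f].
have le_q w (c : R) : D w -> (forall f, nonneg f -> c <= P w f) -> c <= q w.
  move=> Dw hc; apply: lb_le_inf; first by case: (infQ w Dw).
  by move=> _ [f nf <-]; exact: hc.
have sq : sublinear D q.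
  split=> [w w' Dw Dw'|r w r0 Dw].
    rewrite -lerBlDr; apply: (@le_q) => // f nf.
    rewrite lerBlDr -lerBlDl; apply: (@le_q) => // f' nf'; rewrite lerBlDl.
    have nff : nonneg (f + f').
      split=> [x|]; first by rewrite addr_ge0 ?nf.1 ?nf'.1.
      exact: finitely_supportedD nf.2 nf'.2.
    apply: le_trans (q_le _ _ (DD _ _ Dw Dw') nff) _; rewrite /P.
    rewrite translation_defectD addrACA (l1norm_nonnegD nf.1 nf'.1 nf.2 nf'.2).
    have := l1normD (DD _ _ Dw (Td f nf)) (DD _ _ Dw' (Td f' nf')).
    by move=> h; lra.
  rewrite -ler_pdivrMl //; apply: (@le_q) => // f nf; rewrite ler_pdivrMl //.
  have nrf : nonneg (r *: f).
    split=> [x|]; first by rewrite fctE mulr_ge0 ?nf.1 // ltW.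
    exact: finitely_supportedZ nf.2.
  apply: le_trans (q_le _ _ (DZ r _ Dw) nrf) _; rewrite /P.
  rewrite translation_defectZ -scalerDr (l1normZ _ (DD _ _ Dw (Td f nf))).
  by rewrite (l1normZ _ nf.2) gtr0_norm //; lra.
have [phi [phi_q phiD]] := additive_minorant DD DZ sq.
have D0 : D 0 by exact: finitely_supported0.
have phi0 : phi 0 = 0.
  by have := phiD 0 0 D0 D0; rewrite addr0 => h; lra.
have phiN w : D w -> phi (- w) = - phi w.
  by move=> Dw; have := phiD _ _ Dw (DN _ Dw); rewrite subrr phi0 => h; lra.
have phi_l1 w : D w -> `|phi w| <= l1norm w.
  have le w' : D w' -> phi w' <= l1norm w'.
    move=> Dw; apply: le_trans (phi_q _ Dw) _.
    apply: le_trans (q_le _ _ Dw nn0) _; rewrite /P l1norm0 mulr0 subr0.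
    have -> : translation_defect E 0 = 0.
      by apply/funext => z; rewrite /translation_defect subrr if_same.
    by rewrite addr0.
  move=> Dw; rewrite ler_norml le // andbT lerNl -phiN //.
  apply: le_trans (le _ (DN _ Dw)) _.
  by rewrite -scaleN1r (l1normZ _ Dw) normrN1 mul1r.
pose Phi h x := phi (point_mass R (h, x)).
have bPhi h : bounded_real_fun (Phi h).
  exists 1 => x; rewrite -(l1norm_point_mass R (h, x)).
  by apply: phi_l1; exact: point_mass_supported.
have [bc mc] := mean_coboundary E bPhi.
suff : delta <= 0 by rewrite leNgt d0.
rewrite -mc; apply: mean_ge bc _ => x.
have Dpm z : D (point_mass R z) by exact: point_mass_supported.
have phi_sum s : phi (\sum_(h <- s) (point_mass R (h, (h * x)%g) -
    point_mass R (h, x))) = \sum_(h <- s) (Phi h (h * x)%g - Phi h x).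
  elim: s => [|h s IH]; first by rewrite !big_nil phi0.
  have Dh : D (point_mass R (h, (h * x)%g) - point_mass R (h, x)).
    by apply: DD => //; exact: DN.
  rewrite !big_cons phiD // ?IH; last first.
    by apply: finitely_supported_sum => k; apply: DD => //; exact: DN.
  by rewrite phiD //; [rewrite phiN|exact: DN].
rewrite -phi_sum -translation_defect_point_mass //.
have npm : nonneg (point_mass R x).
  by split=> [y|]; [rewrite /point_mass ler0n|exact: point_mass_supported].
have Dt := Td _ npm.
have := phi_q _ (DN _ Dt); rewrite phiN // => h.
have := le_trans h (q_le _ _ (DN _ Dt) npm).
by rewrite /P addNr l1norm0 l1norm_point_mass => h'; lra.
Qed.

End Mean.

(** Reiter's condition: normalize the function [f] found by Day's argument. *)
Theorem almost_invariant_vector (R : realType) (G : groupType) (E : seq G)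
    (eps : R) : amenable R G -> 0 < eps ->
  exists (f : G -> R) (F : seq G), [/\ uniq F, forall x, 0 <= f x,
    forall x, x \notin F -> f x = 0, \sum_(x <- F) f x = 1 &
    forall g (F' : seq G), g \in E -> uniq F' ->
      \sum_(x <- F') `|f (g^-1 * x)%g - f x| <= eps].
Proof.
move=> [m [mlin mpos m1 minv]] e0.
have [f [f0 [F' hF'] small]] :=
  defect_not_bounded_below mlin mpos m1 minv (undup_uniq E) e0.
pose F := undup F'; have uF : uniq F by exact: undup_uniq.
have hF x : x \notin F -> f x = 0 by rewrite mem_undup; exact: hF'.
have c0 : 0 < l1norm f.
  by rewrite -(pmulr_rgt0 _ e0); apply: le_lt_trans small; exact: l1norm_ge0.
set c := l1norm f in small c0.
exists (fun x => f x / c), F; split => //.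
- by move=> x; rewrite divr_ge0 // ltW.
- by move=> x /hF ->; rewrite mul0r.
- rewrite -mulr_suml (_ : \sum_(x <- F) f x = c) ?divff ?gt_eqF //.
  rewrite /c (l1normE uF hF); apply: eq_bigr => x _.
  by rewrite ger0_norm.
move=> g S gE uS.
have : \sum_(x <- S) `|f (g^-1 * x)%g - f x| <= eps * c.
  apply: le_trans (ltW small).
  have [D hD] := translation_defect_supported (undup E) (ex_intro _ F' hF').
  rewrite /l1norm -lee_fin fineK; last first.
    rewrite (esum_support _ (undup_uniq D)) // => z.
    by rewrite mem_undup => /hD ->; rewrite normr0.
  rewrite (_ : \sum_(x <- S) _ = \sum_(z <- [seq (g, x) | x <- S])
      `|translation_defect (undup E) f z|); last first.
    rewrite big_map; apply: eq_bigr => x _.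
    by rewrite /translation_defect /= mem_undup gE.
  apply: sum_le_esum.
  by rewrite (map_inj_uniq (f := pair g)) // => x y [] ->.
rewrite -ler_pdivrMr // mulr_suml; apply: le_trans.
by apply: ler_sum => x _; rewrite -mulrBl normrM (@ger0_norm _ c^-1) // invr_ge0 ltW.
Qed.

(** * The full norm is below the reduced norm *)

Section Unitary.
Variables (R : realType) (G : groupType) (K : hilbertSpace R) (U : G -> K -> K).
Hypothesis unitary : unitary_rep U.

Lemma unitary_norm g x : rnorm (U g x) = rnorm x.
Proof.
case: unitary => _ h _ _; apply/eqP; rewrite -(@eqrXn2 _ 2) ?rnorm_ge0 //.
by rewrite -!ipxx /ip h.
Qed.

Lemma unitaryD g x y : U g (x + y) = U g x + U g y.
Proof. by case: unitary => h _ _ _; have := h g 1 x y; rewrite !scale1r. Qed.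

Lemma unitary0 g : U g 0 = 0.
Proof. by apply: rnorm_eq0; rewrite unitary_norm rnorm0. Qed.

Lemma unitaryZ g (c : R[i]) x : U g (c *: x) = c *: U g x.
Proof.
by case: unitary => h _ _ _; have := h g c x 0; rewrite unitary0 !addr0.
Qed.

Lemma unitary_sum g (I : Type) (s : seq I) (f : I -> K) :
  U g (\sum_(i <- s) f i) = \sum_(i <- s) U g (f i).
Proof.
elim: s => [|i s IH]; first by rewrite !big_nil unitary0.
by rewrite !big_cons unitaryD IH.
Qed.

End Unitary.

Lemma sqr_sqrtB_le (R : realType) (a b : R) : 0 <= a -> 0 <= b ->
  (Num.sqrt a - Num.sqrt b) ^+ 2 <= `|a - b|.
Proof.
wlog ba : a b / b <= a => [hw a0 b0|a0 b0].
  have [|/ltW] := leP b a => h; first exact: hw.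
  by rewrite distrC -sqrrN opprB; exact: hw.
have sba : Num.sqrt b <= Num.sqrt a by rewrite ler_sqrt.
rewrite ger0_norm ?subr_ge0 // -{2}(sqr_sqrtr a0) -{2}(sqr_sqrtr b0) subr_sqr.
by rewrite expr2 ler_wpM2l ?subr_ge0 // lerD2l; have := sqrtr_ge0 b; lra.
Qed.

Lemma sqr_rnormD_le (R : realType) (H : hilbertSpace R) (x y : H) (t : R) :
  0 < t -> rnorm (x + y) ^+ 2 <=
    (1 + t) * rnorm x ^+ 2 + (1 + t^-1) * rnorm y ^+ 2.
Proof.
move=> t0; rewrite sqr_rnormD.
have := sqr_ge0 (rnorm ((t%:C)%C *: x - y)).
rewrite sqr_rnormB ipZl rnormZr gtr0_norm // exprMn => h.
have : 0 <= t^-1 * (t ^+ 2 * rnorm x ^+ 2 - 2 * (t * ip x y) + rnorm y ^+ 2).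
  by rewrite mulr_ge0 // invr_ge0 ltW.
have -> : t^-1 * (t ^+ 2 * rnorm x ^+ 2 - 2 * (t * ip x y) + rnorm y ^+ 2) =
    t * rnorm x ^+ 2 - 2 * ip x y + t^-1 * rnorm y ^+ 2.
  by field; rewrite gt_eqF.
by move=> h'; lra.
Qed.

Section FullLeReduced.
Variables (R : realType) (A : cstarAlgebra R) (G : groupType).
Variables (beta : G -> A -> A) (s : seq (A * G)) (M : R).
Variables (H : hilbertSpace R) (pi : A -> H -> H) (faithful : faithful_rep pi).
Hypothesis reduced : reduced_norm_le beta pi s M.
Variables (K : hilbertSpace R) (rho : A -> K -> K) (U : G -> K -> K).
Hypothesis covariant : covariant_rep beta rho U.

Let w xi (p : A * G) := rho p.1 (U p.2 xi).

(** Fell's absorption principle. The unitary [xi (x) delta_x |-> U x^-1 xi (x) delta_x]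
    of [l^2(G, K)] conjugates the tensor product of [(rho, U)] with the left regular
    representation into the regular representation induced by [rho], which obeys the
    reduced norm bound. The inequality is this bound at the image of [xi (x) v]. *)
Lemma fell_absorption (v : G -> R) (F F' : seq G) xi : uniq F -> uniq F' ->
  (forall x, x \notin F -> v x = 0) ->
  \sum_(x <- F') rnorm (\sum_(p <- s) ((v (p.2^-1 * x)%g)%:C)%C *: w xi p) ^+ 2 <=
  M ^+ 2 * ((\sum_(x <- F) v x ^+ 2) * rnorm xi ^+ 2).
Proof.
move=> uF uF' supp; have [rep unitary cov] := covariant.
pose eta x := ((v x)%:C)%C *: U x^-1%g xi.
have eta0 x : x \notin F -> eta x = 0 by move=> /supp v0; rewrite /eta v0 scale0r.
have := reduced_norm_transfer faithful rep reduced uF uF' eta0.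
have -> : \sum_(x <- F) rnorm (eta x) ^+ 2 = (\sum_(x <- F) v x ^+ 2) * rnorm xi ^+ 2.
  rewrite mulr_suml; apply: eq_bigr => x _.
  rewrite /eta rnormZr (unitary_norm unitary) exprMn -normrX ger0_norm //.
  exact: sqr_ge0.
apply: le_trans; rewrite le_eqVlt; apply/orP; left; apply/eqP.
apply: eq_bigr => x _; rewrite -(unitary_norm unitary x^-1%g) (unitary_sum unitary).
congr (rnorm _ ^+ 2); apply: eq_bigr => p _.
rewrite /induced_rep /left_translation /eta (unitaryZ unitary) (repZ rep).
congr (_ *: _); rewrite cov invgM invgK.
by case: unitary => _ _ -> _.
Qed.

(** If [v] is almost invariant, then [sum_p v(p^-1 x) w_p] is close in l^2 to
    [v(x) sum_p w_p], and [v] has norm 1, so the bound for the tensor product with the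
    regular representation becomes the bound for the covariant representation. With
    [v = sqrt f], l^1-almost invariance of [f] gives l^2-almost invariance of [v]. *)
Theorem covariant_norm_le xi : amenable R G -> 0 <= M ->
  rnorm (\sum_(p <- s) rho p.1 (U p.2 xi)) <= M * rnorm xi.
Proof.
move=> amenableG M0.
rewrite -ler_sqr ?nnegrE ?mulr_ge0 ?rnorm_ge0 // exprMn.
rewrite -/(w xi _); set W := \sum_(p <- s) _; set B := M ^+ 2 * _.
have B0 : 0 <= B by rewrite mulr_ge0 ?sqr_ge0.
pose C := (size s)%:R * \sum_(p <- s) rnorm (w xi p) ^+ 2.
have C0 : 0 <= C by rewrite mulr_ge0 // sumr_ge0 // => p _; exact: sqr_ge0.
have main (t eps : R) : 0 < t -> 0 < eps ->
    rnorm W ^+ 2 <= (1 + t) * B + (1 + t^-1) * (eps * C).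
  move=> t0 e0.
  have [f [F [uF f0 supp f1 hf]]] :=
    almost_invariant_vector [seq p.2 | p <- s] amenableG e0.
  pose v x := Num.sqrt (f x).
  have v2 x : v x ^+ 2 = f x by rewrite sqr_sqrtr.
  have v0 x : x \notin F -> v x = 0 by move=> /supp fx; rewrite /v fx sqrtr0.
  pose a x := \sum_(p <- s) ((v (p.2^-1 * x)%g)%:C)%C *: w xi p.
  pose r x := \sum_(p <- s) ((v x - v (p.2^-1 * x)%g)%:C)%C *: w xi p.
  have aB : \sum_(x <- F) rnorm (a x) ^+ 2 <= B.
    apply: le_trans (fell_absorption xi uF uF v0) _.
    by under [in leLHS]eq_bigr do rewrite v2; rewrite f1 mul1r.
  have rC : \sum_(x <- F) rnorm (r x) ^+ 2 <= eps * C.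
    apply: (@le_trans _ _ (\sum_(x <- F) (size s)%:R *
        \sum_(p <- s) `|f (p.2^-1 * x)%g - f x| * rnorm (w xi p) ^+ 2)).
      apply: ler_sum => x _; apply: le_trans (sqr_rnorm_sum_le _ _) _.
      rewrite ler_wpM2l //; apply: ler_sum => p _.
      rewrite rnormZr exprMn ler_wpM2r ?sqr_ge0 //.
      by rewrite -normrX ger0_norm ?sqr_ge0 // distrC; exact: sqr_sqrtB_le.
    rewrite -mulr_sumr /C mulrCA ler_wpM2l // exchange_big /= mulr_sumr.
    rewrite big_seq [leRHS]big_seq; apply: ler_sum => p ps.
    rewrite -mulr_suml ler_wpM2r ?sqr_ge0 //; apply: hf => //.
    exact: map_f.
  have split_W x : ((v x)%:C)%C *: W = a x + r x.
    rewrite /a /r -big_split scaler_sumr; apply: eq_bigr => p _ /=.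
    by rewrite -scalerDl -rmorphD /= addrC subrK.
  have -> : rnorm W ^+ 2 = \sum_(x <- F) rnorm (a x + r x) ^+ 2.
    rewrite -[LHS]mul1r -f1 mulr_suml; apply: eq_bigr => x _.
    by rewrite -split_W rnormZr exprMn -normrX ger0_norm ?sqr_ge0 // v2.
  apply: le_trans (ler_sum _ (fun x _ => sqr_rnormD_le (a x) (r x) t0)) _.
  rewrite big_split /= -!mulr_sumr lerD // ler_wpM2l // addr_ge0 ?invr_ge0 //.
  - exact: ltW.
  - exact: ltW.
apply/ler_addgt0Pr => e e0.
(* t (B + 1) = e, and eps is such that (1 + 1 / t) eps C <= t *)
pose t := e / (B + 1); pose eps := t ^+ 2 / ((1 + t) * (C + 1)).
have t0 : 0 < t by rewrite divr_gt0 //; lra.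
have t1 : 0 < 1 + t by lra.
have C1 : 0 < C + 1 by lra.
have eps0 : 0 < eps by rewrite divr_gt0 ?exprn_gt0 // mulr_gt0.
apply: le_trans (main t eps t0 eps0) _.
have -> : (1 + t^-1) * (eps * C) = t * (C / (C + 1)).
  by rewrite /eps; field; rewrite !gt_eqF.
have : t * (C / (C + 1)) <= t.
  by rewrite ler_piMr ?(ltW t0) // ler_pdivrMr //; lra.
have : t * (B + 1) = e by rewrite /t divfK // gt_eqF //; lra.
by move=> h h'; lra.
Qed.

End FullLeReduced.

(** * The Hilbert space of square summable families *)

Section NonnegativeSum.
Variables (R : realType) (I : choiceType).
Implicit Types f g : I -> R.

Definition summable_nonneg f : Prop :=
  (forall i, 0 <= f i) /\ (\esum_(i in [set: I]) (f i)%:E < +oo)%E.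

Definition nnsum f : R := fine (\esum_(i in [set: I]) (f i)%:E)%E.

Lemma nnsumE f : summable_nonneg f ->
  (\esum_(i in [set: I]) (f i)%:E = (nnsum f)%:E)%E.
Proof.
move=> [f0 foo]; rewrite fineK // ge0_fin_numE //.
by apply: esum_ge0 => i _; rewrite lee_fin.
Qed.

Lemma nnsum_ge0 f : (forall i, 0 <= f i) -> 0 <= nnsum f.
Proof. by move=> f0; apply/fine_ge0/esum_ge0 => i _; rewrite lee_fin. Qed.

Lemma sum_le_nnsum f (s : seq I) : summable_nonneg f -> uniq s ->
  \sum_(i <- s) f i <= nnsum f.
Proof. by move=> sf us; rewrite -lee_fin -nnsumE //; exact: sum_le_esum. Qed.

Lemma nnsum_le_bound f (c : R) : (forall i, 0 <= f i) ->
  (forall s, uniq s -> \sum_(i <- s) f i <= c) ->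
  summable_nonneg f /\ nnsum f <= c.
Proof.
move=> f0 hc; have h := esum_le_bound hc.
have sf : summable_nonneg f by split=> //; exact: le_lt_trans h (ltry _).
by split; [|rewrite -lee_fin -nnsumE].
Qed.

Lemma nnsumD f g : summable_nonneg f -> summable_nonneg g ->
  summable_nonneg (fun i => f i + g i) /\
  nnsum (fun i => f i + g i) = nnsum f + nnsum g.
Proof.
move=> sf sg; have e : (\esum_(i in [set: I]) (f i + g i)%:E =
    (nnsum f + nnsum g)%:E)%E.
  under eq_esum do rewrite EFinD.
  rewrite esumD; first by rewrite !nnsumE.
    by move=> i _; rewrite lee_fin; case: sf.
  by move=> i _; rewrite lee_fin; case: sg.
split; last by rewrite /nnsum e.
by split; [move=> i; rewrite addr_ge0 ?sf.1 ?sg.1|rewrite e ltry].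
Qed.

Lemma nnsumZ (c : R) f : 0 <= c -> summable_nonneg f ->
  summable_nonneg (fun i => c * f i) /\ nnsum (fun i => c * f i) = c * nnsum f.
Proof.
move=> c0 sf.
have le (d : R) g : 0 <= d -> summable_nonneg g ->
    summable_nonneg (fun i => d * g i) /\ nnsum (fun i => d * g i) <= d * nnsum g.
  move=> d0 sg; apply: nnsum_le_bound => [i|s us].
    by rewrite mulr_ge0 ?sg.1.
  by rewrite -mulr_sumr ler_wpM2l // sum_le_nnsum.
have [scf lecf] := le _ _ c0 sf; split=> //; apply/le_anti; rewrite lecf /=.
have [c1|c1] := eqVneq c 0.
  by rewrite c1 mul0r; apply: nnsum_ge0 => i; rewrite mul0r.
have cp : 0 < c by rewrite lt_neqAle eq_sym c1.
have [_] := le c^-1 _ (ltW (etrans (invr_gt0 c) cp)) scf.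
under [X in nnsum X]eq_fun do rewrite mulKf ?gt_eqF //.
by rewrite ler_pdivlMl.
Qed.

End NonnegativeSum.

Section SquareSummable.
Variables (R : realType) (I : choiceType) (H : hilbertSpace R).
Implicit Types x y : I -> H.

Definition l2mem : {pred I -> H} :=
  fun x => `[< summable_nonneg (fun i => rnorm (x i) ^+ 2) >].

Lemma l2memP x : x \in l2mem <-> summable_nonneg (fun i => rnorm (x i) ^+ 2).
Proof. by split=> [/asboolP|h]; last exact/asboolP. Qed.

Lemma l2mem_sum x (c : R) :
  (forall s, uniq s -> \sum_(i <- s) rnorm (x i) ^+ 2 <= c) ->
  x \in l2mem /\ nnsum (fun i => rnorm (x i) ^+ 2) <= c.
Proof.
move=> h; have [|hx le] := nnsum_le_bound _ h.
  by move=> i; exact: sqr_ge0.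
by split=> //; apply/l2memP.
Qed.

Lemma l2_triangle x y : x \in l2mem -> y \in l2mem ->
  x + y \in l2mem /\ nnsum (fun i => rnorm ((x + y) i) ^+ 2) <=
    (Num.sqrt (nnsum (fun i => rnorm (x i) ^+ 2)) +
     Num.sqrt (nnsum (fun i => rnorm (y i) ^+ 2))) ^+ 2.
Proof.
move=> /l2memP sx /l2memP sy; apply: l2mem_sum => s us.
set a := nnsum _; set b := nnsum _.
have a0 : 0 <= a by apply: nnsum_ge0 => i; exact: sqr_ge0.
have b0 : 0 <= b by apply: nnsum_ge0 => i; exact: sqr_ge0.
have ha := sum_le_nnsum sx us; have hb := sum_le_nnsum sy us.
have hab : \sum_(i <- s) ip (x i) (y i) <= Num.sqrt a * Num.sqrt b.
  apply: le_trans (ler_norm _) _.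
  rewrite -ler_sqr ?nnegrE ?mulr_ge0 ?sqrtr_ge0 // -normrX ger0_norm ?sqr_ge0 //.
  rewrite exprMn !sqr_sqrtr //; apply: le_trans (ip_sum_le _ _ _) _.
  by apply: ler_pM => //; apply: sumr_ge0 => i _; exact: sqr_ge0.
under eq_bigr do rewrite sqr_rnormD.
rewrite !big_split /= -mulr_sumr sqrrD !sqr_sqrtr // -mulr_natl.
by rewrite -/a -/b in ha hb *; lra.
Qed.

Lemma l2_scale (c : R[i]) x : x \in l2mem ->
  c *: x \in l2mem /\ nnsum (fun i => rnorm ((c *: x) i) ^+ 2) =
    complex.Re `|c| ^+ 2 * nnsum (fun i => rnorm (x i) ^+ 2).
Proof.
move=> /l2memP sx; have [] := nnsumZ (sqr_ge0 (complex.Re `|c|)) sx.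
have -> : (fun i => complex.Re `|c| ^+ 2 * rnorm (x i) ^+ 2) =
    (fun i => rnorm ((c *: x) i) ^+ 2).
  by apply/funext => i; rewrite fctE rnormZ exprMn.
by move=> h ->; split=> //; apply/l2memP.
Qed.

Lemma l2mem_submod : GRing.submod_closed l2mem.
Proof.
split=> [|c x y hx hy].
  apply: (l2mem_sum (c := 0) _).1 => s _.
  by rewrite big1 // => i _; rewrite rnorm0 expr0n.
exact: (l2_triangle (l2_scale c hx).1 hy).1.
Qed.

HB.instance Definition _ := GRing.isSubmodClosed.Build R[i] (I -> H) l2mem
  l2mem_submod.

Record l2 := L2 { l2val : I -> H; l2valP : l2val \in l2mem }.

HB.instance Definition _ := [isSub for l2val].
HB.instance Definition _ := [Choice of l2 by <:].
HB.instance Definition _ := [SubChoice_isSubLmodule of l2 by <:].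

Implicit Types u v : l2.

Definition l2sq u : R := nnsum (fun i => rnorm (l2val u i) ^+ 2).

Lemma l2sum u : summable_nonneg (fun i => rnorm (l2val u i) ^+ 2).
Proof. exact/l2memP/l2valP. Qed.

Lemma l2sq_ge0 u : 0 <= l2sq u.
Proof. by apply: nnsum_ge0 => i; exact: sqr_ge0. Qed.

Lemma l2valD u v i : l2val (u + v) i = l2val u i + l2val v i.
Proof. by []. Qed.

Lemma l2valB u v i : l2val (u - v) i = l2val u i - l2val v i.
Proof. by []. Qed.

Lemma l2valZ (c : R[i]) u i : l2val (c *: u) i = c *: l2val u i.
Proof. by []. Qed.

Lemma l2sq_coord u i : rnorm (l2val u i) ^+ 2 <= l2sq u.
Proof.
by have := sum_le_nnsum (s := [:: i]) (l2sum u) isT; rewrite big_seq1.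
Qed.

Definition l2norm u : R[i] := ((Num.sqrt (l2sq u))%:C)%C.

Lemma l2normD u v : l2norm (u + v) <= l2norm u + l2norm v.
Proof.
rewrite /l2norm -rmorphD /= lecR.
rewrite -ler_sqr ?nnegrE ?addr_ge0 ?sqrtr_ge0 // sqr_sqrtr ?l2sq_ge0 //.
exact: (l2_triangle (l2valP u) (l2valP v)).2.
Qed.

Lemma l2sqZ (c : R[i]) u : l2sq (c *: u) = complex.Re `|c| ^+ 2 * l2sq u.
Proof. exact: (l2_scale c (l2valP u)).2. Qed.

Lemma l2normZ (c : R[i]) u : l2norm (c *: u) = `|c| * l2norm u.
Proof.
have cE : `|c| = ((complex.Re `|c|)%:C)%C by rewrite RRe_real ?ger0_real.
have c0 : 0 <= complex.Re `|c| by rewrite -ler0c -cE.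
rewrite /l2norm l2sqZ sqrtrM ?sqr_ge0 // sqrtr_sqr ger0_norm //.
by rewrite rmorphM /= -cE.
Qed.

Lemma l2norm_eq0 u : l2norm u = 0 -> u = 0.
Proof.
move=> /complexI/eqP; rewrite sqrtr_eq0 => h; apply: val_inj; apply/funext => i.
apply: rnorm_eq0; apply/eqP; rewrite -sqrf_eq0 -sqrf_eq0; apply/eqP.
by apply/le_anti; rewrite !sqr_ge0 andbT; have := l2sq_coord u i; nra.
Qed.

HB.instance Definition _ := Lmodule_isNormed.Build R[i] l2 l2normD l2normZ
  l2norm_eq0.

Lemma l2_rnorm u : rnorm u = Num.sqrt (l2sq u).
Proof. by []. Qed.

Lemma l2_rnorm2 u : rnorm u ^+ 2 = l2sq u.
Proof. by rewrite l2_rnorm sqr_sqrtr // l2sq_ge0. Qed.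

End SquareSummable.

Section L2Hilbert.
Variables (R : realType) (I : choiceType) (H : hilbertSpace R).
Local Notation l2 := (l2 I H).
Implicit Types u v w : l2.

(** A Cauchy filter converges coordinatewise, and bounds on finite partial sums of
    [|v - u|^2] pass to the coordinatewise limit, which is therefore square summable
    and a limit in norm. *)
Lemma l2_complete (F : set_system l2) : ProperFilter F -> cauchy F -> cvg F.
Proof.
move=> FF /cauchyP Fc.
have Fball (e : R) : 0 < e -> exists u, F [set v | rnorm (u - v) < e].
  move=> e0; have [|u hu] := Fc (e%:C)%C; first by rewrite ltcR.
  exists u; apply: filterS hu => v; rewrite -ball_normE /ball_ /=.
  by rewrite rnorm_lt.
have coord_le v i : rnorm (l2val v i) <= rnorm v.
  rewrite -ler_sqr ?nnegrE ?rnorm_ge0 // l2_rnorm2; exact: l2sq_coord.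
have cvg_coord i : cvg ((fun v => l2val v i) @ F).
  apply: cauchy_cvg; apply/cauchyP => e e0.
  have eE : e = ((complex.Re e)%:C)%C by rewrite RRe_real // gtr0_real.
  have Re0 : 0 < complex.Re e by rewrite -ltcR -eE.
  have [u hu] := Fball _ Re0; exists (l2val u i).
  suff : F [set v | ball (l2val u i) e (l2val v i)] by [].
  apply: filterS hu => v huv; rewrite /= -ball_normE /ball_ /= eE -rnorm_lt.
  exact: le_lt_trans (coord_le (u - v) i) huv.
pose z i : H := lim ((fun v => l2val v i) @ F).
have near_z i (d : R) : 0 < d -> F [set v | rnorm (z i - l2val v i) < d].
  move=> d0; have /cvgrPdist_lt/(_ (d%:C)%C) := cvg_coord i.
  rewrite ltcR => /(_ d0); apply: filterS => v /=.
  by rewrite rnorm_lt.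
have near_zs (s : seq I) (d : R) : 0 < d ->
    F [set v | forall i, i \in s -> rnorm (z i - l2val v i) < d].
  move=> d0; elim: s => [|i s IH]; first by apply: filterS filterT.
  apply: filterS2 IH (near_z i d d0) => v h1 h2 j.
  by rewrite inE => /predU1P[->//|/h1].
have close (e : R) u : 0 < e -> F [set v | rnorm (u - v) < e] ->
    forall s, uniq s -> \sum_(i <- s) rnorm (z i - l2val u i) ^+ 2 <= e ^+ 2.
  move=> e0 hu s us; apply/ler_addgt0Pr => d d0.
  pose n : R := (size s)%:R.
  (* t and d' make (1 + t) e^2 + (1 + 1 / t) n d'^2 at most e^2 + d *)
  pose t := d / (2 * e ^+ 2).
  have t0 : 0 < t by rewrite divr_gt0 // mulr_gt0 // exprn_gt0.
  pose b := (1 + t^-1) * n + 1.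
  have b0 : 0 < b.
    by rewrite ltr_wpDl // mulr_ge0 ?ler0n // addr_ge0 // invr_ge0 ltW.
  pose d' := Num.sqrt (d / (2 * b)).
  have d'0 : 0 < d' by rewrite sqrtr_gt0 divr_gt0 // mulr_gt0.
  have [v [huv hv]] := filter_ex (filterI hu (near_zs s d' d'0)).
  have h1 : \sum_(i <- s) rnorm (l2val v i - l2val u i) ^+ 2 <= e ^+ 2.
    apply: (@le_trans _ _ (rnorm (v - u) ^+ 2)).
      by rewrite l2_rnorm2; exact: sum_le_nnsum (l2sum (v - u)) us.
    by rewrite rnormB ler_sqr ?nnegrE ?rnorm_ge0 // ltW.
  have h2 : \sum_(i <- s) rnorm (z i - l2val v i) ^+ 2 <= n * d' ^+ 2.
    rewrite /n -sum1_size natr_sum mulr_suml big_seq [leRHS]big_seq.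
    apply: ler_sum => i si; rewrite mul1r ler_sqr ?nnegrE ?rnorm_ge0 //.
      by rewrite ltW // hv.
    exact: ltW.
  have h3 : \sum_(i <- s) rnorm (z i - l2val u i) ^+ 2 <=
      (1 + t) * e ^+ 2 + (1 + t^-1) * (n * d' ^+ 2).
    apply: (@le_trans _ _ (\sum_(i <- s) ((1 + t) *
        rnorm (l2val v i - l2val u i) ^+ 2 +
        (1 + t^-1) * rnorm (z i - l2val v i) ^+ 2))).
      apply: ler_sum => i _.
      have -> : z i - l2val u i = (l2val v i - l2val u i) + (z i - l2val v i).
        by rewrite [RHS]addrC addrA subrK.
      exact: sqr_rnormD_le.
    rewrite big_split /= -!mulr_sumr lerD // ler_wpM2l // addr_ge0 ?invr_ge0 //.
    - exact: ltW.
    - exact: ltW.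
  apply: le_trans h3 _.
  have te : t * e ^+ 2 = d / 2 by rewrite /t; field; rewrite gt_eqF.
  have d2 : d' ^+ 2 = d / (2 * b).
    by rewrite sqr_sqrtr // divr_ge0 ?mulr_ge0 // ltW.
  have bd : b * d' ^+ 2 = d / 2 by rewrite d2; field; rewrite gt_eqF.
  have := sqr_ge0 d'; move: bd; rewrite /b mulrDl mul1r -mulrA => bd dd.
  by rewrite mulrDl mul1r te; lra.
have [u0 hu0] := Fball 1 ltr01.
have close1 := close 1 u0 ltr01 hu0.
have zu0 : (fun i => z i - l2val u0 i) \in @l2mem R I H by case: (l2mem_sum close1).
have zmem : z \in @l2mem R I H.
  have zE : (fun i => z i - l2val u0 i) + l2val u0 = z.
    by apply/funext => i; rewrite fctE subrK.
  by have [+ _] := l2_triangle zu0 (l2valP u0); rewrite zE.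
pose zl : l2 := L2 zmem.
apply/cvg_ex; exists zl; apply/cvgrPdist_lt => e e0.
have eE : e = ((complex.Re e)%:C)%C by rewrite RRe_real // gtr0_real.
have Re0 : 0 < complex.Re e by rewrite -ltcR -eE.
have e2 : 0 < complex.Re e / 2 by rewrite divr_gt0.
have [u hu] := Fball _ e2; have [_ zu] := l2mem_sum (close _ u e2 hu).
apply: filterS hu => v huv.
rewrite eE -rnorm_lt -(subrKA u) (le_lt_trans (rnormD _ _)) //.
rewrite [ltRHS]splitr ler_ltD //.
rewrite -ler_sqr ?nnegrE ?rnorm_ge0 ?(ltW e2) // l2_rnorm2.
exact: zu.
Qed.

End L2Hilbert.

HB.instance Definition _ (R : realType) (I : choiceType) (H : hilbertSpace R) :=
  Uniform_isComplete.Build (l2 I H) (@l2_complete R I H).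

Section L2Dot.
Variables (R : realType) (I : choiceType) (H : hilbertSpace R).
Local Notation l2 := (l2 I H).
Implicit Types u v w : l2.

(** The real part of the inner product, defined by polarization, so that bilinearity
    becomes a family of identities [sum f + ... = sum g + ...] between sums of
    nonnegative families, which hold because they hold at each index. *)
Definition l2ip u v : R := (l2sq (u + v) - l2sq (u - v)) / 4.

Lemma nnsum3 (f g h : I -> R) : summable_nonneg f -> summable_nonneg g ->
  summable_nonneg h -> nnsum f + nnsum g + nnsum h =
    nnsum (fun i => f i + g i + h i).
Proof.
move=> sf sg sh; have [sfg <-] := nnsumD sf sg.
by have [_ <-] := nnsumD sfg sh.
Qed.

Lemma l2sqN u : l2sq (- u) = l2sq u.
Proof. by rewrite -scaleN1r l2sqZ normrN1 expr1n mul1r. Qed.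

Lemma l2sqi u : l2sq ('i%C *: u) = l2sq u.
Proof.
by rewrite l2sqZ normc_def /= expr0n expr1n add0r sqrtr1 expr1n mul1r.
Qed.

Lemma l2ipC u v : l2ip u v = l2ip v u.
Proof. by rewrite /l2ip [u + v]addrC -(opprB v u) l2sqN. Qed.

Lemma l2ipDl u u' v : l2ip (u + u') v = l2ip u v + l2ip u' v.
Proof.
suff : l2sq (u + u' + v) + l2sq (u - v) + l2sq (u' - v) =
       l2sq (u + u' - v) + l2sq (u + v) + l2sq (u' + v).
  rewrite /l2ip; move: (l2sq (u + u' + v)) (l2sq (u + u' - v)) (l2sq (u + v))
    (l2sq (u - v)) (l2sq (u' + v)) (l2sq (u' - v)) => a b c d e f h.
  by lra.
rewrite /l2sq !nnsum3; try exact: l2sum.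
congr nnsum; apply/funext => i; rewrite !(l2valB, l2valD).
by rewrite !(sqr_rnormB, sqr_rnormD, ipDl); ring.
Qed.

Lemma l2ipNl u v : l2ip (- u) v = - l2ip u v.
Proof.
by rewrite /l2ip -[l2sq (- u + v)]l2sqN opprD opprK -opprD l2sqN -mulNr opprB.
Qed.

Lemma l2ipZl (r : R) u v : l2ip ((r%:C)%C *: u) v = r * l2ip u v.
Proof.
wlog r0 : r u / 0 <= r => [hw|].
  have [|/ltW r0] := leP 0 r; first exact: hw.
  have := hw (- r) (- u); rewrite oppr_ge0 => /(_ r0).
  by rewrite rmorphN scaleNr scalerN opprK => ->; rewrite l2ipNl mulrNN.
suff : l2sq ((r%:C)%C *: u + v) + r * l2sq (u - v) =
       l2sq ((r%:C)%C *: u - v) + r * l2sq (u + v).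
  rewrite /l2ip; move: (l2sq (_ *: u + v)) (l2sq (_ *: u - v)) (l2sq (u + v))
    (l2sq (u - v)) => a b c d h.
  by lra.
rewrite /l2sq.
have [s1 <-] := nnsumZ r0 (l2sum (u - v)).
have [s2 <-] := nnsumZ r0 (l2sum (u + v)).
have [_ <-] := nnsumD (l2sum ((r%:C)%C *: u + v)) s1.
have [_ <-] := nnsumD (l2sum ((r%:C)%C *: u - v)) s2.
congr nnsum; apply/funext => i; rewrite !(l2valB, l2valD, l2valZ).
by rewrite !(sqr_rnormB, sqr_rnormD, ipZl); ring.
Qed.

Lemma l2ipil u v : l2ip ('i%C *: u) v = - l2ip u ('i%C *: v).
Proof.
have ii (x : l2) : 'i%C *: ('i%C *: x) = - x.
  by rewrite scalerA -expr2 sqr_i scaleN1r.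
rewrite /l2ip -[l2sq (_ + v)]l2sqi -[l2sq (_ - v)]l2sqi.
rewrite scalerDr scalerBr !ii -[l2sq (- u + _)]l2sqN opprD opprK.
by rewrite -[l2sq (- u - _)]l2sqN opprD !opprK -mulNr opprB addrC.
Qed.

(** The imaginary part of [<u, v>] is the real part of [<u, i v>]. *)
Definition l2dot u v : R[i] := Complex (l2ip u v) (l2ip u ('i%C *: v)).

Lemma l2dotJ u v : l2dot u v = Num.conj (l2dot v u).
Proof.
have -> : Num.conj (l2dot v u) = Complex (l2ip v u) (- l2ip v ('i%C *: u)) by [].
by rewrite /l2dot (l2ipC v u) (l2ipC v ('i%C *: u)) l2ipil opprK.
Qed.

Lemma l2dotC u v : l2dot u v = (-1) ^+ false * Num.conj (l2dot v u).
Proof. by rewrite expr0 mul1r -l2dotJ. Qed.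

Lemma l2dot_linear v : linear_for *%R (l2dot^~ v).
Proof.
move=> [a b] u u'.
have -> : Complex a b *: u = (a%:C)%C *: u + (b%:C)%C *: ('i%C *: u).
  by rewrite scalerA -scalerDl [(b%:C)%C * _]mulrC [in LHS](complexE (Complex a b)).
rewrite /l2dot !(l2ipDl, l2ipZl) l2ipil [l2ip ('i%C *: u) ('i%C *: v)]l2ipil.
rewrite scalerA -expr2 sqr_i scaleN1r [l2ip u (- v)]l2ipC l2ipNl (l2ipC v u).
move: (l2ip u v) (l2ip u' v) (l2ip u ('i%C *: v)) (l2ip u' ('i%C *: v)) => p q r s.
rewrite -[RHS]/(Complex (a * p - b * r + q) (a * r + b * p + s)).
by rewrite opprK mulrN.
Qed.

Lemma l2dot_bilinear : bilinear_for *%R (Num.conj \; *%R) l2dot.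
Proof.
split=> [v|u]; first exact: l2dot_linear.
move=> c v v'.
rewrite (l2dotJ u (_ + _)) (l2dotJ u v) (l2dotJ u v').
have -> := l2dot_linear u c v v'.
by rewrite rmorphD rmorphM.
Qed.

Lemma l2dotE u : l2dot u u = ((l2sq u)%:C)%C.
Proof.
apply/eqP; rewrite eq_complex /=; apply/andP; split; apply/eqP.
  rewrite /l2ip subrr -mulr2n -scaler_nat l2sqZ normr_nat.
  have -> : l2sq (0 : l2) = 0.
    by rewrite -(scale0r 0) l2sqZ normr0 expr0n mul0r.
  have -> : complex.Re (2 : R[i]) = 2 by [].
  by field.
by have := l2ipil u u; rewrite l2ipC; move: (l2ip _ _) => a h; lra.
Qed.

Lemma l2dot_gt0 u : u != 0 -> 0 < l2dot u u.
Proof.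
move=> u0; rewrite l2dotE ltcR lt_neqAle l2sq_ge0 andbT eq_sym.
apply: contra u0 => /eqP h; apply/eqP/rnorm_eq0.
by rewrite l2_rnorm h sqrtr0.
Qed.

HB.instance Definition _ := bilinear_isBilinear.Build R[i] l2 l2 R[i]
  *%R (Num.conj \; *%R) l2dot l2dot_bilinear.
HB.instance Definition _ := isHermitianSesquilinear.Build R[i] l2 false Num.conj
  l2dot l2dotC.
HB.instance Definition _ := isDotProduct.Build R[i] l2 l2dot l2dot_gt0.

Definition l2_dot : {dot l2 for Num.conj} := l2dot.

Lemma l2_normE u : `|u| ^+ 2 = l2_dot u u.
Proof.
have -> : l2_dot u u = ((l2sq u)%:C)%C := l2dotE u.
by rewrite -l2_rnorm2 rnormE -rmorphXn.
Qed.

Definition l2_hilbert : hilbertSpace R := HilbertSpace l2_normE.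

End L2Dot.

(** * The reduced norm is below the full norm *)

Section RegularRepresentation.
Variables (R : realType) (A : cstarAlgebra R) (G : groupType).
Variables (beta : G -> A -> A) (action : cstar_action beta).
Variables (H : hilbertSpace R) (pi : A -> H -> H) (rep : star_rep pi).
Local Notation l2 := (l2 G H).

Lemma action_lin g (c : R[i]) a b : beta g (c *: a + b) = c *: beta g a + beta g b.
Proof. by case: (action.1 g) => -[h _ _] _; exact: h. Qed.

Lemma actionM g a b : beta g (a * b) = beta g a * beta g b.
Proof. by case: (action.1 g) => -[_ [_ h] _] _; exact: h. Qed.

Lemma action_one g : beta g 1 = 1.
Proof. by case: (action.1 g) => -[_ [h _] _] _. Qed.

Lemma action_star g a : beta g (star a) = star (beta g a).
Proof. by case: (action.1 g) => -[_ _ h] _; exact: h. Qed.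

(** The coordinates of the induced representation are representations of [A], hence
    contractive. *)
Lemma twisted_rep g : star_rep (fun a => pi (beta g a)).
Proof.
case: (rep) => -[h1 h2] h3 h4 h5; split=> [|a b x|x|a x y].
- by split=> [a|c a b x]; [exact: h1|rewrite action_lin h2].
- by rewrite actionM h3.
- by rewrite action_one h4.
- by rewrite h5 action_star.
Qed.

Lemma induced_norm_le a (x : G -> H) g :
  rnorm (induced_rep beta pi a x g) <= rnorm a * rnorm (x g).
Proof. exact: (rep_contractive (twisted_rep g^-1%g)). Qed.

Lemma induced_l2 a (x : l2) : induced_rep beta pi a (l2val x) \in @l2mem R G H.
Proof.
apply: (l2mem_sum (c := rnorm a ^+ 2 * l2sq x) _).1 => s us.
apply: le_trans (ler_wpM2l (sqr_ge0 _) (sum_le_nnsum (l2sum x) us)).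
rewrite mulr_sumr; apply: ler_sum => g _; rewrite -exprMn.
by rewrite ler_sqr ?nnegrE ?mulr_ge0 ?rnorm_ge0 // induced_norm_le.
Qed.

Definition regular_rep a (x : l2) : l2 := L2 (induced_l2 a x).

Lemma translation_sum (h : G) (x : G -> H) :
  (\esum_(g in [set: G]) (rnorm (left_translation h x g) ^+ 2)%:E =
   \esum_(g in [set: G]) (rnorm (x g) ^+ 2)%:E)%E.
Proof.
apply/esym; apply: reindex_esum; split=> // [g g' _ _ /mulgI //|g _].
by exists (h * g)%g; rewrite //= mulKg.
Qed.

Lemma translation_l2 h (x : l2) : left_translation h (l2val x) \in @l2mem R G H.
Proof.
apply/l2memP; split=> [g|]; first exact: sqr_ge0.
by rewrite translation_sum; case: (l2sum x).
Qed.

Definition regular_unitary h (x : l2) : l2 := L2 (translation_l2 h x).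

Lemma l2_eq (x y : l2) : (forall g, l2val x g = l2val y g) -> x = y.
Proof. by move=> h; apply: val_inj; apply/funext. Qed.

(** The cross terms in the polarization formula are the pointwise inner products. *)
Lemma l2ip_eq (x y x' y' : l2) :
  (forall g, ip (l2val x g) (l2val y g) = ip (l2val x' g) (l2val y' g)) ->
  l2ip x y = l2ip x' y'.
Proof.
move=> h.
suff : l2sq (x + y) + l2sq (x' - y') = l2sq (x - y) + l2sq (x' + y').
  rewrite /l2ip; move: (l2sq (x + y)) (l2sq (x - y)) (l2sq (x' + y'))
    (l2sq (x' - y')) => a b c d e.
  by lra.
rewrite /l2sq.
have [_ <-] := nnsumD (l2sum (x + y)) (l2sum (x' - y')).
have [_ <-] := nnsumD (l2sum (x - y)) (l2sum (x' + y')).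
congr nnsum; apply/funext => g; rewrite !(l2valB, l2valD).
by rewrite !(sqr_rnormB, sqr_rnormD) h; ring.
Qed.

Lemma regular_star_rep :
  @star_rep R A (l2_hilbert G H) regular_rep.
Proof.
split=> [|a b x|x|a x y].
- split=> [a|c a b x]; last first.
    by apply: l2_eq => g; case: (twisted_rep g^-1%g) => -[_ h] _ _ _; exact: h.
  split=> [c x y|].
    apply: l2_eq => g.
    by case: (twisted_rep g^-1%g) => -[h _] _ _ _; case: (h a) => l _; exact: l.
  exists (rnorm a) => x.
  rewrite -ler_sqr ?nnegrE ?mulr_ge0 ?rnorm_ge0 // exprMn !l2_rnorm2.
  apply: (nnsum_le_bound (c := rnorm a ^+ 2 * l2sq x) _ _).2 => [g|s us].
    exact: sqr_ge0.
  apply: le_trans (ler_wpM2l (sqr_ge0 _) (sum_le_nnsum (l2sum x) us)).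
  rewrite mulr_sumr; apply: ler_sum => g _; rewrite -exprMn.
  by rewrite ler_sqr ?nnegrE ?mulr_ge0 ?rnorm_ge0 // induced_norm_le.
- by apply: l2_eq => g; exact: (repM (twisted_rep g^-1%g)).
- by apply: l2_eq => g; exact: (rep1 (twisted_rep g^-1%g)).
- have adj (z : l2) : l2ip (regular_rep a x) z = l2ip x (regular_rep (star a) z).
    by apply: l2ip_eq => g; exact: (rep_adj (twisted_rep g^-1%g)).
  rewrite /= /l2_dot /l2dot !adj; congr (Complex _ (l2ip _ _)).
  apply: l2_eq => g; rewrite l2valZ.
  exact: (repZ (twisted_rep g^-1%g)).
Qed.

Lemma regular_unitary_rep : @unitary_rep R G (l2_hilbert G H) regular_unitary.
Proof.
have lin g (c : R[i]) x y : regular_unitary g (c *: x + y) =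
    c *: regular_unitary g x + regular_unitary g y by exact: l2_eq.
have norm g x : l2sq (regular_unitary g x) = l2sq x.
  by rewrite /l2sq /nnsum translation_sum.
have uD g x y : regular_unitary g (x + y) =
    regular_unitary g x + regular_unitary g y by exact: l2_eq.
have uB g x y : regular_unitary g (x - y) =
    regular_unitary g x - regular_unitary g y by exact: l2_eq.
have uip g x y : l2ip (regular_unitary g x) (regular_unitary g y) = l2ip x y.
  by rewrite /l2ip -uD -uB !norm.
split=> [g c x y|g x y|g h x|x]; first exact: lin.
- have ui : 'i%C *: regular_unitary g y = regular_unitary g ('i%C *: y).
    exact: l2_eq.
  by rewrite /= /l2_dot /l2dot ui !uip.
- by apply: l2_eq => k; rewrite /= /left_translation invgM mulgA.
- by apply: l2_eq => k; rewrite /= /left_translation invg1 mul1g.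
Qed.

Lemma regular_covariant_rep :
  @covariant_rep R A G beta (l2_hilbert G H) regular_rep regular_unitary.
Proof.
split=> [||g a x]; [exact: regular_star_rep|exact: regular_unitary_rep|].
apply: l2_eq => k; rewrite /= /left_translation /induced_rep.
by rewrite invgM invgK action.2.
Qed.

Lemma l2val_sum (J : Type) (s : seq J) (f : J -> l2) g :
  l2val (\sum_(j <- s) f j) g = \sum_(j <- s) l2val (f j) g.
Proof.
elim: s => [|j s IH]; first by rewrite !big_nil.
by rewrite !big_cons l2valD IH.
Qed.

(** The regular representation on [l^2(G, H)] is one of the covariant representations
    that define the full norm. *)
Theorem full_reduced_norm_le (s : seq (A * G)) (M : R) : 0 <= M ->
  full_norm_le beta s M -> reduced_norm_le beta pi s M.
Proof.
move=> M0 full xi xioo.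
have xi2 : xi \in @l2mem R G H.
  by apply/l2memP; split=> // g; exact: sqr_ge0.
pose x : l2 := L2 xi2.
have := full _ _ _ regular_covariant_rep x.
rewrite -ler_sqr ?nnegrE ?mulr_ge0 ?rnorm_ge0 // exprMn.
set y : l2 := (X in rnorm X); rewrite (l2_rnorm2 y) (l2_rnorm2 x) => le.
have -> : l2_sqnorm xi = ((l2sq x)%:E)%E by exact: nnsumE (l2sum x).
rewrite (_ : l2_sqnorm _ = ((l2sq y)%:E)%E) ?lee_fin //.
rewrite -(nnsumE (l2sum y)); apply: eq_esum => g _.
by rewrite /y l2val_sum.
Qed.

End RegularRepresentation.

(** * Extension of an isometric *-correspondence *)

Section Correspondence.
Variables (R : realType) (T : Type) (B1 B2 : cstarAlgebra R).
Variables (I1 : T -> B1) (I2 : T -> B2).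

Definition dense_range (B : cstarAlgebra R) (J : T -> B) : Prop :=
  forall (b : B) (e : R), 0 < e -> exists t, rnorm (b - J t) < e.

(** The closure of the graph of [I1 t |-> I2 t]; unlike an extension by limits, it
    is symmetric in the two algebras, so each of its properties serves the
    isomorphism and its inverse. *)
Definition related (b : B1) (c : B2) : Prop :=
  forall e : R, 0 < e -> exists t, rnorm (b - I1 t) < e /\ rnorm (c - I2 t) < e.

Hypothesis isometric : forall t, rnorm (I1 t) = rnorm (I2 t).
Variables (lin : R[i] -> T -> T -> T).
Hypothesis lin1 : forall c s t, I1 (lin c s t) = c *: I1 s + I1 t.
Hypothesis lin2 : forall c s t, I2 (lin c s t) = c *: I2 s + I2 t.

Lemma related_code t : related (I1 t) (I2 t).
Proof. by move=> e e0; exists t; rewrite !subrr !rnorm0. Qed.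

Lemma related_norm b c : related b c -> rnorm b = rnorm c.
Proof.
move=> h; suff close (e : R) : 0 < e -> `|rnorm b - rnorm c| <= e.
  apply/eqP; rewrite -subr_eq0 -normr_le0; apply/ler_addgt0Pr => e e0.
  by rewrite add0r; exact: close.
move=> e0; have [|t [hb hc]] := h (e / 2); first by rewrite divr_gt0.
have hbt := rnormD (b - I1 t) (I1 t); have htb := rnormD (I1 t - b) b.
have hct := rnormD (c - I2 t) (I2 t); have htc := rnormD (I2 t - c) c.
move: hbt htb hct htc; rewrite !subrK isometric [rnorm (I1 t - b)]rnormB.
rewrite [rnorm (I2 t - c)]rnormB => h1 h2 h3 h4.
by rewrite ler_norml; apply/andP; split; lra.
Qed.

Lemma related_lin (a : R[i]) b c b' c' : related b c -> related b' c' ->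
  related (a *: b + b') (a *: c + c').
Proof.
move=> h h' e e0; pose k := complex.Re `|a| + 1.
have a0 : 0 <= complex.Re `|a|.
  by rewrite -ler0c RRe_real // ger0_real.
have k0 : 0 < k by rewrite /k; lra.
have [|t [hb hc]] := h (e / 2 / k); first by rewrite !divr_gt0.
have [|t' [hb' hc']] := h' (e / 2); first by rewrite divr_gt0.
have est (B : cstarAlgebra R) (x x' y y' : B) : rnorm (x - y) < e / 2 / k ->
    rnorm (x' - y') < e / 2 -> rnorm (a *: x + x' - (a *: y + y')) < e.
  move=> hx hx'; rewrite opprD addrACA -scalerBr.
  rewrite (le_lt_trans (rnormD _ _)) // rnormZ [ltRHS]splitr ler_ltD //.
  apply: (@le_trans _ _ (k * (e / 2 / k))).
    by apply: ler_pM; rewrite ?rnorm_ge0 ?(ltW hx) // /k lerDl.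
  by rewrite mulrC divfK // gt_eqF.
by exists (lin a t t'); rewrite lin1 lin2; split; exact: est.
Qed.

Lemma related_unique b c c' : related b c -> related b c' -> c = c'.
Proof.
move=> h h'; have := related_norm (related_lin (-1) h h').
rewrite !scaleN1r addNr rnorm0 => /esym/rnorm_eq0/eqP.
by rewrite addrC subr_eq0 eq_sym => /eqP.
Qed.

Lemma related_mul (mul : T -> T -> T) b c b' c' :
  (forall s t, I1 (mul s t) = I1 s * I1 t) ->
  (forall s t, I2 (mul s t) = I2 s * I2 t) ->
  related b c -> related b' c' -> related (b * b') (c * c').
Proof.
move=> mul1 mul2 h h' e e0.
pose k := rnorm b + rnorm c + rnorm b' + rnorm c' + 2.
have [n1 n2 n3 n4] : [/\ 0 <= rnorm b, 0 <= rnorm c, 0 <= rnorm b' & 0 <= rnorm c'].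
  by rewrite !rnorm_ge0.
have k0 : 0 < k by rewrite /k; lra.
pose d := Num.min 1 (e / k).
have d0 : 0 < d by rewrite lt_min ltr01 divr_gt0.
have d1 : d <= 1 by rewrite ge_min lexx.
have dk : d * k <= e by rewrite -ler_pdivlMr // ge_min lexx orbT.
have [t [hb hc]] := h d d0; have [t' [hb' hc']] := h' d d0.
have est (B : cstarAlgebra R) (x x' y y' : B) : rnorm (x - y) < d ->
    rnorm (x' - y') < d -> rnorm x + rnorm x' + 2 <= k ->
    rnorm (x * x' - y * y') < e.
  move=> hx hx' hk.
  have -> : x * x' - y * y' = x * (x' - y') + (x - y) * y'.
    by rewrite mulrBr mulrBl addrA subrK.
  have y1 : rnorm y' <= rnorm x' + 1.
    have := rnormD x' (y' - x'); rewrite addrC subrK [rnorm (y' - _)]rnormB.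
    by move=> h1; lra.
  apply: le_lt_trans (rnormD _ _) _.
  apply: le_lt_trans (lerD (rnormM _ _) (rnormM _ _)) _.
  apply: (@le_lt_trans _ _ (rnorm x * d + d * (rnorm x' + 1))).
    by apply: lerD; apply: ler_pM; rewrite ?rnorm_ge0 // ltW.
  apply: lt_le_trans dk; rewrite mulrC -mulrDr ltr_pM2l //; lra.
by exists (mul t t'); rewrite mul1 mul2; split; apply: est => //; rewrite /k; lra.
Qed.

Lemma related_star (st : T -> T) b c :
  (forall t, I1 (st t) = star (I1 t)) -> (forall t, I2 (st t) = star (I2 t)) ->
  related b c -> related (star b) (star c).
Proof.
move=> st1 st2 h e e0; have [t [hb hc]] := h e e0; exists (st t).
by rewrite st1 st2 -!starN -!starD !rnorm_star.
Qed.

Lemma related_exists (b : B1) : dense_range I1 -> exists c, related b c.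
Proof.
move=> dense.
have pos n : 0 < n.+1%:R^-1 :> R by rewrite invr_gt0 ltr0n.
have [t ht] := choice (fun n => dense b _ (pos n)).
have anti n m : (n <= m)%N -> m.+1%:R^-1 <= n.+1%:R^-1 :> R.
  by move=> nm; rewrite lef_pV2 ?posrE ?ltr0n // ler_nat.
have small (d : R) : 0 < d -> exists n, 2 / n.+1%:R < d by exact: invn_lt.
have [c hc] : exists c, forall n, rnorm (I2 (t n) - c) <= 2 / n.+1%:R.
  apply: (cauchy_limit (u := fun n => I2 (t n) : cs_banach B2)) => // n m nm.
  have -> : I2 (t n) - I2 (t m) = I2 (lin (-1) (t m) (t n)).
    by rewrite lin2 scaleN1r addrC.
  rewrite -isometric lin1 scaleN1r addrC -(subrKA b).
  apply: le_trans (rnormD _ _) _; rewrite [rnorm (_ - b)]rnormB.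
  have := ht n; have := ht m; have := anti n m nm.
  move: (n.+1%:R^-1) (m.+1%:R^-1) => x y h1 h2 h3.
  by lra.
exists c => e e0; have [n hn] := small e e0; exists (t n); split.
  have := ht n; have := pos n; move: hn; move: (n.+1%:R^-1) => x h1 h2 h3.
  by lra.
by rewrite rnormB; exact: le_lt_trans (hc n) hn.
Qed.

End Correspondence.

Lemma relatedC (R : realType) (T : Type) (B1 B2 : cstarAlgebra R)
    (I1 : T -> B1) (I2 : T -> B2) b c : related I1 I2 b c -> related I2 I1 c b.
Proof. by move=> h e e0; have [t [? ?]] := h e e0; exists t. Qed.

(** The closure of the graph of [I1 t |-> I2 t] is the graph of a bijection, because
    it preserves norms in both directions and both ranges are dense in complete
    algebras. It inherits the *-algebra operations, which act on the codes [T]. *)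
Theorem star_isomorphism_extension (R : realType) (T : Type)
    (B1 B2 : cstarAlgebra R) (I1 : T -> B1) (I2 : T -> B2)
    (lin : R[i] -> T -> T -> T) (mul : T -> T -> T) (st : T -> T) (one : T) :
  (forall t, rnorm (I1 t) = rnorm (I2 t)) ->
  dense_range I1 -> dense_range I2 ->
  (forall c s t, I1 (lin c s t) = c *: I1 s + I1 t) ->
  (forall c s t, I2 (lin c s t) = c *: I2 s + I2 t) ->
  (forall s t, I1 (mul s t) = I1 s * I1 t) ->
  (forall s t, I2 (mul s t) = I2 s * I2 t) ->
  (forall t, I1 (st t) = star (I1 t)) -> (forall t, I2 (st t) = star (I2 t)) ->
  I1 one = 1 -> I2 one = 1 ->
  exists theta : B1 -> B2, [/\ star_hom theta, bijective theta &
    forall t, theta (I1 t) = I2 t].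
Proof.
move=> iso dense1 dense2 lin1 lin2 mul1 mul2 st1 st2 one1 one2.
have iso' t : rnorm (I2 t) = rnorm (I1 t) by [].
have [theta hth] := choice (fun b => related_exists iso lin1 lin2 b dense1).
have [theta' hth'] := choice (fun b => related_exists iso' lin2 lin1 b dense2).
have uniq1 b c : related I1 I2 b c -> theta b = c.
  exact: (related_unique iso lin1 lin2 (hth b)).
have uniq2 b c : related I1 I2 b c -> theta' c = b.
  by move=> /relatedC; exact: (related_unique iso' lin2 lin1 (hth' c)).
exists theta; split=> [||t]; last by apply: uniq1; exact: related_code.
- split=> [a x y||x].
  + by apply: uniq1; exact: (related_lin lin1 lin2).
  + split=> [|x y]; last by apply: uniq1; exact: (related_mul mul1 mul2).
    by apply: uniq1; rewrite -one1 -one2; exact: related_code.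
  + by apply: uniq1; exact: (related_star st1 st2).
- by exists theta' => x; [apply: uniq2|apply: uniq1; apply/relatedC].
Qed.

(** * The *-algebra of finitely supported functions *)

Section Codes.
Variables (R : realType) (A : cstarAlgebra R) (G : groupType).
Variables (beta : G -> A -> A).

(** The codes are finite lists of pairs [(a, g)], each standing for [a g]; the
    operations below are those of the twisted *-algebra [C_c(G, A)]. *)
Definition code_lin (c : R[i]) (s t : seq (A * G)) : seq (A * G) :=
  [seq (c *: p.1, p.2) | p <- s] ++ t.

Definition code_mul (s t : seq (A * G)) : seq (A * G) :=
  [seq (p.1 * beta p.2 q.1, (p.2 * q.2)%g) | p <- s, q <- t].

Definition code_star (s : seq (A * G)) : seq (A * G) :=
  [seq (beta p.2^-1%g (star p.1), p.2^-1%g) | p <- s].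

Variables (B : cstarAlgebra R) (norm_le : seq (A * G) -> R -> Prop).
Variables (j : A -> B) (u : G -> B).
Hypothesis crossed : crossed_product_completion beta norm_le j u.

Lemma integrated_lin c s t : integrated j u (code_lin c s t) =
  c *: integrated j u s + integrated j u t.
Proof.
have [[jlin _ _] _ _ _ _] := crossed.
have j0 : j 0 = 0.
  have := jlin 1 0 0; rewrite !scale1r addr0 => /(congr1 (fun z => z - j 0)).
  by rewrite subrr addrK.
rewrite /integrated /code_lin big_cat big_map scaler_sumr /=; congr (_ + _).
apply: eq_bigr => p _; have := jlin c p.1 0; rewrite !addr0 j0 addr0 => ->.
by rewrite scalerAl.
Qed.

Lemma covariance g a : u g * j a = j (beta g a) * u g.
Proof.
have [_ [_ _ uu] cov _ _] := crossed.
by rewrite -cov -!mulrA (uu g).1 mulr1.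
Qed.

Lemma star_unitary g : star (u g) = u g^-1%g.
Proof.
have [_ [u1 uM uu] _ _ _] := crossed.
by rewrite -[LHS]mul1r -u1 -(mulVg g) uM -mulrA (uu g).2 mulr1.
Qed.

Lemma integrated_mul s t : integrated j u (code_mul s t) =
  integrated j u s * integrated j u t.
Proof.
have [[_ [_ jM] _] [_ uM _] _ _ _] := crossed.
rewrite /integrated /code_mul big_allpairs_dep /= mulr_suml.
apply: eq_bigr => p _; rewrite mulr_sumr; apply: eq_bigr => q _ /=.
by rewrite jM uM !mulrA -[X in _ = X * _]mulrA covariance !mulrA.
Qed.

Lemma integrated_star s : integrated j u (code_star s) = star (integrated j u s).
Proof.
have [[_ _ jS] _ _ _ _] := crossed.
rewrite /integrated /code_star big_map star_sum; apply: eq_bigr => p _ /=.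
by rewrite starM star_unitary -jS covariance.
Qed.

Lemma integrated_one : integrated j u [:: (1, 1%g)] = 1.
Proof.
have [[_ [j1 _] _] [u1 _ _] _ _ _] := crossed.
by rewrite /integrated big_seq1 /= j1 u1 mulr1.
Qed.

Lemma integrated_dense : dense_range (integrated j u).
Proof.
have [_ _ _ dense _] := crossed => b e e0.
have : closure (range (integrated j u)) b by rewrite dense.
move=> /(_ (ball b (e%:C)%C)) [].
  by apply: nbhsx_ballx; rewrite ltcR.
move=> _ [[t _ <-]]; rewrite -ball_normE /ball_ /= => h.
by exists t; rewrite rnorm_lt.
Qed.

Lemma integrated_norm_le s (M : R) : 0 <= M ->
  rnorm (integrated j u s) <= M <-> norm_le s M.
Proof. by have [_ _ _ _ h] := crossed; exact: h. Qed.

End Codes.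

(** * Crossed products by amenable groups *)

(** Both crossed products are completions of the same *-algebra. The reduced norm is
    at most the full norm since the regular representation is covariant, and the full
    norm is at most the reduced norm by amenability. *)
Theorem crossed_product_isomorphism (R : realType) (G : groupType)
    (A : cstarAlgebra R) (beta : G -> A -> A)
    (Br : cstarAlgebra R) (jr : A -> Br) (lam : G -> Br)
    (Bf : cstarAlgebra R) (jf : A -> Bf) (u : G -> Bf) :
  amenable R G -> cstar_action beta -> reduced_crossed_product beta jr lam ->
  full_crossed_product beta jf u ->
  exists theta : Bf -> Br, [/\ star_hom theta, bijective theta &
    forall s, theta (integrated jf u s) = integrated jr lam s].
Proof.
move=> amenableG action [H [pi [faithful red]]] full.
have iso s : rnorm (integrated jf u s) = rnorm (integrated jr lam s).
  apply/le_anti/andP; split.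
    apply/(integrated_norm_le full _ (rnorm_ge0 _)) => K rho U cov xi.
    apply: (covariant_norm_le faithful _ cov xi amenableG (rnorm_ge0 _)).
    exact/(integrated_norm_le red _ (rnorm_ge0 _)).
  apply/(integrated_norm_le red _ (rnorm_ge0 _)).
  apply: (full_reduced_norm_le action faithful.1 (rnorm_ge0 _)).
  exact/(integrated_norm_le full _ (rnorm_ge0 _)).
apply: (star_isomorphism_extension iso (integrated_dense full)
  (integrated_dense red) (integrated_lin full) (integrated_lin red)
  (integrated_mul full) (integrated_mul red) (integrated_star full)
  (integrated_star red) (integrated_one full) (integrated_one red)).
Qed.

Lemma star_isomorphism_cs_pos (R : realType) (A B : cstarAlgebra R)
    (theta : A -> B) n (X : 'M[A]_n) : star_hom theta -> bijective theta ->
  cs_pos X <-> cs_pos (map_mx theta X).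
Proof.
move=> [lin [_ mul] st] [theta' thK thK'].
have th0 : theta 0 = 0.
  have := lin 1 0 0; rewrite !scale1r addr0 => /(congr1 (fun z => z - theta 0)).
  by rewrite subrr addrK.
have thD x y : theta (x + y) = theta x + theta y.
  by have := lin 1 x y; rewrite !scale1r.
have thS (I : Type) (s : seq I) (f : I -> A) :
    theta (\sum_(i <- s) f i) = \sum_(i <- s) theta (f i).
  elim: s => [|i s IH]; first by rewrite !big_nil.
  by rewrite !big_cons thD IH.
have thX (Y : 'M[A]_n) : map_mx theta (mxstar (@star R A) Y *m Y) =
    mxstar (@star R B) (map_mx theta Y) *m map_mx theta Y.
  apply/matrixP => i k; rewrite !mxE thS; apply: eq_bigr => l _.
  by rewrite mul !mxE st.
split=> [[Y ->]|[Y hY]]; first by exists (map_mx theta Y).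
exists (map_mx theta' Y).
have YE : Y = map_mx theta (map_mx theta' Y).
  by apply/matrixP => i k; rewrite !mxE thK'.
apply/matrixP => i k; apply: (can_inj thK).
move: hY; rewrite YE -thX => /matrixP/(_ i k).
by rewrite [LHS]mxE [RHS]mxE -YE.
Qed.

Theorem proposition4p13 (R : realType) (S : operatorSystem R) (G : groupType)
    (gen : set G) (alpha : G -> S -> S)
    (dynamics : os_dynamical_system gen alpha)
    (amenableG : amenable R G)
    (* the C*-envelope of S, with the extension of alpha *)
    (A : cstarAlgebra R) (iota : S -> A) (envelope : cstar_envelope iota)
    (beta : G -> A -> A) (action : cstar_action beta)
    (extension : forall g s, beta g (iota s) = iota (alpha g s))
    (* its reduced and full crossed products by G *)
    (Br : cstarAlgebra R) (jr : A -> Br) (lam : G -> Br)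
    (reduced : reduced_crossed_product beta jr lam)
    (Bf : cstarAlgebra R) (jf : A -> Bf) (u : G -> Bf)
    (full : full_crossed_product beta jf u) :
  exists theta : Bf -> Br,
    ucoi_between (os_crossed_product gen iota jf u)
                 (os_crossed_product gen iota jr lam) theta /\
    forall (s : S) (g : G), gen g ->
      theta (jf (iota s) * u g) = jr (iota s) * lam g.
Proof.
have [theta [hom bij thetaE]] :=
  crossed_product_isomorphism amenableG action reduced full.
have thetaS (s : seq (S * G)) : theta (\sum_(p <- s) jf (iota p.1) * u p.2) =
    \sum_(p <- s) jr (iota p.1) * lam p.2.
  have := thetaE [seq (iota p.1, p.2) | p <- s].
  by rewrite /integrated !big_map.
exists theta; split; last first.
  by move=> s g _; have := thetaS [:: (s, g)]; rewrite !big_seq1.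
case: (hom) => lin [theta1 _] _; split=> //.
- by move=> a x y _ _; exact: lin.
- split.
  + by move=> _ [s hs ->]; exists s => //; exact: thetaS.
  + by move=> x y _ _; exact: bij_inj.
  + move=> _ [s hs ->]; exists (\sum_(p <- s) jf (iota p.1) * u p.2) => //.
    by exists s.
- by move=> n X _; exact: star_isomorphism_cs_pos.
Qed.
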